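(* Let $d \ge 2$ and let $F \in M_b(\mathbb{R}^d;\mathbb{R}^d)$ be a finite $\mathbb{R}^d$-valued Radon measure such that $\operatorname{div} F = 0$ in the sense of distributions. Then there exist positive integers $n_l$ ($l \in \mathbb{N}$) and $C^1$ closed curves $\Gamma_{i,l}$, $i \in \{1,\dots,n_l\}$, $l \in \mathbb{N}$, with parameterizations by arclength $\gamma_{i,l} \in C^1([0,L_{i,l}];\mathbb{R}^d)$ (so $|\dot\gamma_{i,l}| \equiv 1$ and $|\Gamma_{i,l}| = L_{i,l}$), where $l \le L_{i,l} \le 2l$, such that \[ F = \lim_{l \to \infty} \frac{\|F\|_{M_b(\mathbb{R}^d;\mathbb{R}^d)}}{n_l \cdot l} \sum_{i=1}^{n_l} \dot{\gamma}_{i,l}\, \mathcal{H}^1\llcorner \Gamma_{i,l} \] weakly-star in the sense of measures (i.e. when tested against every $\Phi \in C_0(\mathbb{R}^d;\mathbb{R}^d)$), and \[ \lim_{l \to \infty} \frac{1}{n_l \cdot l} \sum_{i=1}^{n_l} |\Gamma_{i,l}| = 1. \]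
   Context: $M_b(\mathbb{R}^d;\mathbb{R}^d)$ denotes the space of finite $\mathbb{R}^d$-valued Radon measures on $\mathbb{R}^d$ with the total variation norm $\|\cdot\|_{M_b(\mathbb{R}^d;\mathbb{R}^d)}$, identified with the dual of $C_0(\mathbb{R}^d;\mathbb{R}^d)$ (continuous vector fields vanishing at infinity with the sup norm). For a closed curve $\Gamma$ parametrized by arclength via $\gamma:[0,L]\to\mathbb{R}^d$, $\dot\gamma\,\mathcal{H}^1\llcorner\Gamma$ denotes the vector measure acting by $\Phi \mapsto \int_0^L \dot\gamma(t)\cdot\Phi(\gamma(t))\,dt$ for $\Phi \in C_0(\mathbb{R}^d;\mathbb{R}^d)$; $|\Gamma|$ denotes the length of $\Gamma$. $\operatorname{div} F = 0$ in the sense of distributions means $\int \nabla\varphi \cdot dF = 0$ for all $\varphi \in C_c^\infty(\mathbb{R}^d)$. *)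

(* Defs.v *)
From HB Require Import structures.
From mathcomp Require Import all_boot all_order all_algebra.
From mathcomp Require Import all_classical all_reals all_analysis.
Set Implicit Arguments. Unset Strict Implicit. Unset Printing Implicit Defensive.
Import Order.TTheory GRing.Theory Num.Theory.
Import numFieldNormedType.Exports.
Local Open Scope classical_set_scope.
Local Open Scope ring_scope.

Definition dotv {R : realType} {d : nat} (u v : 'rV[R]_d) : R :=
  \sum_(j < d) u ord0 j * v ord0 j.
Definition enorm {R : realType} {d : nat} (u : 'rV[R]_d) : R :=
  Num.sqrt (dotv u u).

Definition C0field {R : realType} {d : nat} (Phi : 'rV[R]_d -> 'rV[R]_d) : Prop :=
  continuous Phi /\
  (forall e : R, 0 < e -> exists r : R, forall x, r < enorm x -> enorm (Phi x) < e).

Definition supnorm {R : realType} {d : nat} (Phi : 'rV[R]_d -> 'rV[R]_d) : R :=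
  sup [set enorm (Phi x) | x in setT].

(* A finite R^d-valued Radon measure, viewed (Riesz) as a bounded linear
   functional on C_0(R^d;R^d): F Phi = \int Phi . dF.  Its values on non-C_0
   fields are irrelevant. *)
Definition finite_vector_measure {R : realType} {d : nat}
    (F : ('rV[R]_d -> 'rV[R]_d) -> R) : Prop :=
  (forall Phi Psi, C0field Phi -> C0field Psi ->
      F (fun x => Phi x + Psi x) = F Phi + F Psi) /\
  (forall (a : R) Phi, C0field Phi -> F (fun x => a *: Phi x) = a * F Phi) /\
  (exists M : R, forall Phi, C0field Phi -> `|F Phi| <= M * supnorm Phi).

(* Total variation norm = dual norm. *)
Definition mnorm {R : realType} {d : nat} (F : ('rV[R]_d -> 'rV[R]_d) -> R) : R :=
  sup [set F Phi | Phi in [set Phi | C0field Phi /\ supnorm Phi <= 1]].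

Fixpoint iter_dir {R : realType} {d : nat} (vs : seq 'rV[R]_d)
    (f : 'rV[R]_d -> R) : 'rV[R]_d -> R :=
  match vs with
  | [::] => f
  | v :: vs' => fun x => 'D_v (iter_dir vs' f) x
  end.

Definition smooth {R : realType} {d : nat} (f : 'rV[R]_d -> R) : Prop :=
  forall (vs : seq 'rV[R]_d) x, differentiable (iter_dir vs f) x.

Definition compact_support {R : realType} {d : nat} (f : 'rV[R]_d -> R) : Prop :=
  exists r : R, forall x, r < enorm x -> f x = 0.

Definition evec {R : realType} {d : nat} (i : 'I_d) : 'rV[R]_d :=
  \row_(j < d) (if j == i then 1 else 0).

Definition grad {R : realType} {d : nat} (f : 'rV[R]_d -> R) (x : 'rV[R]_d) : 'rV[R]_d :=
  \row_(i < d) 'D_(evec i) f x.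

Definition div_free {R : realType} {d : nat} (F : ('rV[R]_d -> 'rV[R]_d) -> R) : Prop :=
  forall phi : 'rV[R]_d -> R, smooth phi -> compact_support phi -> F (grad phi) = 0.

Definition arclength_C1_closed_curve {R : realType} {d : nat}
    (gamma : R -> 'rV[R]_d) (L : R) : Prop :=
  0 <= L /\
  (forall t, t \in `[0, L] -> derivable gamma t 1) /\
  {within `[0, L], continuous (derive1 gamma)} /\
  (forall t, t \in `[0, L] -> enorm ((derive1 gamma) t) = 1) /\
  gamma 0 = gamma L /\ (derive1 gamma) 0 = (derive1 gamma) L.

(* Action of the vector measure  gamma' H^1 |_ Gamma  on a test field Phi. *)
Definition curve_action {R : realType} {d : nat}
    (gamma : R -> 'rV[R]_d) (L : R) (Phi : 'rV[R]_d -> 'rV[R]_d) : R :=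
  Rintegral lebesgue_measure `[0, L] (fun t => dotv ((derive1 gamma) t) (Phi (gamma t))).

(* Main.v *)
(* Duality instead of a decomposition of [F].  If every closed unit-speed curve satisfies
   [\int_g Psi <= lam * length], the infimum [u] of [lam * length - \int Psi] over the curves
   from a fixed point is finite (close the curve up) and satisfies
   [u (y + z) - u y <= lam |z| - Psi y . z + o(|z|)], as in weak KAM theory.  Clamped to have
   compact support and mollified, it becomes a test function [phi] with
   [|grad phi + Psi| <= lam + eta], so that [F Psi = F (grad phi + Psi) <= |F| (lam + eta)].
   Hence for every [Psi] some closed curve has mean action at least [F Psi / |F| - eta]; a greedy
   choice of such curves gives uniform averages that converge to [F / |F|] on any finite family
   of fields, and running through each curve several times adjusts its length to
   [[l, (1 + o(1)) l]].  Interpolating on finer and finer grids reduces [C_0] to finite families,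
   and a diagonal choice concludes. *)
Require Import Defs.
From HB Require Import structures.
From mathcomp Require Import all_boot all_order all_algebra.
From mathcomp Require Import all_classical all_reals all_analysis.
From mathcomp Require Import ring lra zify.
Import Order.TTheory GRing.Theory Num.Theory.
Import numFieldNormedType.Exports.
Local Open Scope classical_set_scope.
Local Open Scope ring_scope.

(** * Euclidean norm *)

Section Euclid.
Context {R : realType} {d : nat}.
Implicit Types (u v w : 'rV[R]_d) (a : R).

(** The requirement that the curves be [C^1] and closed shapes the estimates, because concatenated
    paths have corners. In dimension at least 2 a curve can come back to its starting point with any
    other velocity within arbitrarily small length. Corners therefore cost nothing in the infimum
    [u], and every arc is built with prescribed velocities at both ends. The one-sided inequality
    for [u] suffices: it is linear in [u], so it survives averaging with nonnegative weights, and
    once [phi] is differentiable, testing it in all directions [z] bounds [|grad phi + Psi|]. The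
    mollification is a finite sum of translated bumps, so that [phi] lies in an explicit class of
    smooth functions. The subsolution is built for [lam > 0]. If [F Psi / |F| - eta] is not
    positive, a short loop outside the support of [Psi] has zero action and is already good enough.
    If [F = 0], division by the norm gives 0 by convention and the same construction yields curves
    whose averaged mean actions tend to 0. *)

Lemma dotvC u v : dotv u v = dotv v u.
Proof. by apply: eq_bigr => j _; rewrite mulrC. Qed.

Lemma dotvDl u v w : dotv (u + v) w = dotv u w + dotv v w.
Proof. by rewrite -big_split; apply: eq_bigr => j _; rewrite mxE mulrDl. Qed.

Lemma dotvDr u v w : dotv u (v + w) = dotv u v + dotv u w.
Proof. by rewrite dotvC dotvDl !(dotvC u). Qed.

Lemma dotvZl a u v : dotv (a *: u) v = a * dotv u v.
Proof. by rewrite mulr_sumr; apply: eq_bigr => j _; rewrite mxE mulrA. Qed.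

Lemma dotvZr a u v : dotv u (a *: v) = a * dotv u v.
Proof. by rewrite dotvC dotvZl dotvC. Qed.

Lemma dotvNl u v : dotv (- u) v = - dotv u v.
Proof. by rewrite -scaleN1r dotvZl mulN1r. Qed.

Lemma dotvNr u v : dotv u (- v) = - dotv u v.
Proof. by rewrite dotvC dotvNl dotvC. Qed.

Lemma dotv0l u : dotv 0 u = 0.
Proof. by rewrite /dotv big1// => j _; rewrite mxE mul0r. Qed.

Lemma dotv0r u : dotv u 0 = 0.
Proof. by rewrite dotvC dotv0l. Qed.

Lemma dotv_suml (I : finType) (c : I -> R) (w : I -> 'rV[R]_d) u :
  dotv (\sum_i c i *: w i) u = \sum_i c i * dotv (w i) u.
Proof.
elim/big_rec2: _ => [|i y1 y2 _ IH]; first by rewrite dotv0l.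
by rewrite dotvDl dotvZl IH.
Qed.

Lemma dotv_sumr (I : finType) (c : I -> R) (w : I -> 'rV[R]_d) u :
  dotv u (\sum_i c i *: w i) = \sum_i c i * dotv u (w i).
Proof. by rewrite dotvC dotv_suml; apply: eq_bigr => i _; rewrite dotvC. Qed.

Lemma dotvv_ge0 u : 0 <= dotv u u.
Proof. by apply: sumr_ge0 => j _; rewrite -expr2 sqr_ge0. Qed.

Lemma dotvvE u : dotv u u = enorm u ^+ 2.
Proof. by rewrite /enorm sqr_sqrtr// dotvv_ge0. Qed.

Lemma enorm_ge0 u : 0 <= enorm u.
Proof. exact: sqrtr_ge0. Qed.

Lemma ler_coord_enorm u j : `|u ord0 j| <= enorm u.
Proof.
rewrite -sqrtr_sqr ler_wsqrtr// expr2 /dotv (bigD1 j)//= lerDl.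
by apply: sumr_ge0 => k _; rewrite -expr2 sqr_ge0.
Qed.

Lemma enorm_eq0 u : enorm u = 0 -> u = 0.
Proof.
move=> u0; apply/rowP => j; rewrite mxE; apply/eqP.
by rewrite -normr_le0 -u0 ler_coord_enorm.
Qed.

Lemma enorm0 : enorm (0 : 'rV[R]_d) = 0.
Proof. by rewrite /enorm dotv0l sqrtr0. Qed.

Lemma enormZ a u : enorm (a *: u) = `|a| * enorm u.
Proof.
by rewrite /enorm dotvZl dotvZr mulrA -expr2 sqrtrM ?sqr_ge0// sqrtr_sqr.
Qed.

Lemma enormN u : enorm (- u) = enorm u.
Proof. by rewrite -scaleN1r enormZ normrN1 mul1r. Qed.

Lemma dotv_le u v : dotv u v <= enorm u * enorm v.
Proof.
have [u0|u0] := eqVneq (enorm u) 0.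
  by rewrite (enorm_eq0 _ u0) dotv0l enorm0 mul0r.
have [v0|v0] := eqVneq (enorm v) 0.
  by rewrite (enorm_eq0 _ v0) dotv0r enorm0 mulr0.
have up : 0 < enorm u by rewrite lt_neqAle eq_sym u0 enorm_ge0.
have vp : 0 < enorm v by rewrite lt_neqAle eq_sym v0 enorm_ge0.
have := dotvv_ge0 (enorm v *: u - enorm u *: v).
rewrite !dotvDl !dotvDr !dotvNl !dotvNr !dotvZl !dotvZr (dotvC v u) !dotvvE => H.
rewrite -(ler_pM2l (mulr_gt0 up vp)) -subr_ge0; nra.
Qed.

Lemma ler_norm_dotv u v : `|dotv u v| <= enorm u * enorm v.
Proof.
by rewrite ler_norml dotv_le andbT lerNl -dotvNl -(enormN u) dotv_le.
Qed.

Lemma ler_enormD u v : enorm (u + v) <= enorm u + enorm v.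
Proof.
rewrite -(@ler_pXn2r _ 2)// ?nnegrE ?addr_ge0 ?enorm_ge0//.
rewrite -dotvvE dotvDl !dotvDr (dotvC v u) !dotvvE.
have := dotv_le u v; nra.
Qed.

Lemma ler_enormB u v : enorm (u - v) <= enorm u + enorm v.
Proof. by rewrite -(enormN v) ler_enormD. Qed.

Lemma enormB u v : enorm (u - v) = enorm (v - u).
Proof. by rewrite -enormN opprB. Qed.

Lemma ler_enorm_sum (I : finType) (w : I -> 'rV[R]_d) :
  enorm (\sum_i w i) <= \sum_i enorm (w i).
Proof.
elim/big_rec2: _ => [|i y1 y2 _ IH]; first by rewrite enorm0.
by rewrite (le_trans (ler_enormD _ _))// lerD2l.
Qed.

Lemma evecE (i j : 'I_d) : evec i ord0 j = (j == i)%:R :> R.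
Proof. by rewrite mxE; case: eqP. Qed.

Lemma row_sum_evec u : u = \sum_j u ord0 j *: evec j.
Proof.
apply/rowP => k; rewrite summxE (bigD1 k)//= big1 ?addr0.
  by rewrite mxE evecE eqxx mulr1.
by move=> j jk; rewrite mxE evecE eq_sym (negbTE jk) mulr0.
Qed.

Lemma enorm_evec (i : 'I_d) : enorm (evec i : 'rV[R]_d) = 1.
Proof.
rewrite /enorm /dotv (bigD1 i)//= big1 ?addr0.
  by rewrite evecE eqxx mulr1 sqrtr1.
by move=> j ji; rewrite evecE (negbTE ji) mulr0.
Qed.

Lemma dotv_evec u (i : 'I_d) : dotv u (evec i) = u ord0 i.
Proof.
rewrite /dotv (bigD1 i)//= big1 ?addr0 ?evecE ?eqxx ?mulr1//.
by move=> j ji; rewrite evecE (negbTE ji) mulr0.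
Qed.

Lemma ler_enorm_sum_coord u : enorm u <= \sum_j `|u ord0 j|.
Proof.
rewrite {1}(row_sum_evec u).
apply: (le_trans (ler_enorm_sum 'I_d (fun j => u ord0 j *: evec j))).
by apply: ler_sum => j _; rewrite enormZ enorm_evec mulr1.
Qed.

Lemma ler_enorm_coord u a : (forall j, `|u ord0 j| <= a) -> enorm u <= d%:R * a.
Proof.
move=> h; rewrite (le_trans (ler_enorm_sum_coord u))//.
rewrite (@le_trans _ _ (\sum_(j < d) a))//; first exact: ler_sum.
by rewrite sumr_const card_ord mulr_natl.
Qed.

Lemma ler_enorm_mx_norm u : enorm u <= d%:R * `|u|.
Proof.
apply: ler_enorm_coord => j; rewrite [leRHS]/Num.norm /= mx_normrE.
by apply/bigmax_geP; right; exists (ord0, j).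
Qed.

Lemma ler_mx_norm_enorm u : `|u| <= enorm u.
Proof.
rewrite [leLHS]/Num.norm /= mx_normrE.
by apply: bigmax_le => [|[i j] _]; [exact: enorm_ge0|rewrite /= ord1; exact: ler_coord_enorm].
Qed.

End Euclid.

(** * Vanishing vector fields and their functionals *)

Section C0fields.
Context {R : realType} {d : nat}.
Implicit Types (Phi Psi : 'rV[R]_d -> 'rV[R]_d).

Lemma continuous_enormP Phi x : {for x, continuous Phi} <->
  (forall e, 0 < e -> exists2 r, 0 < r &
    forall y, enorm (y - x) < r -> enorm (Phi y - Phi x) < e).
Proof.
have d0 : 0 < d%:R + 1 :> R by rewrite ltr_wpDl.
split => [cx e e0|H].
  have e1 : 0 < e / (d%:R + 1) by rewrite divr_gt0.
  have /cvgrPdist_lt/(_ _ e1)/nbhs_ballP[r /= r0 Hr] := cx.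
  exists r => // y xy; rewrite enormB.
  have /Hr /= h : ball x r y.
    by rewrite -ball_normE /= (le_lt_trans (ler_mx_norm_enorm _))// enormB.
  rewrite (le_lt_trans (ler_enorm_mx_norm _))//.
  rewrite (@le_lt_trans _ _ ((d%:R + 1) * `|Phi x - Phi y|))//.
    by rewrite ler_wpM2r// lerDl.
  by rewrite mulrC -ltr_pdivlMr.
apply/(@cvgrPdist_lt _ _ _ (nbhs x) _ Phi (Phi x)) => e e0.
have [r r0 Hr] := H e e0.
apply/nbhs_ballP; exists (r / (d%:R + 1)) => /=; first exact: divr_gt0.
move=> y; rewrite -ball_normE /= => xy.
rewrite (le_lt_trans (ler_mx_norm_enorm _))// enormB Hr// enormB.
rewrite (le_lt_trans (ler_enorm_mx_norm _))//.
rewrite (@le_lt_trans _ _ ((d%:R + 1) * `|x - y|))//.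
  by rewrite ler_wpM2r// lerDl.
by rewrite mulrC -ltr_pdivlMr.
Qed.

Lemma compact_cube (M : R) :
  compact [set v : 'rV[R]_d | forall i, v ord0 i \in `[(- M), M]].
Proof.
apply: (@rV_compact _ _ (fun=> `[(- M), M]%classic)).
by move=> _; apply: segment_compact.
Qed.

Lemma C0field_bounded Phi : C0field Phi ->
  exists2 M, 0 <= M & forall x, enorm (Phi x) <= M.
Proof.
move=> [cPhi /(_ 1 ltr01)[r Hr]].
have /compact_near_coveringP/near_covering_withinP := compact_cube (`|r| + 1).
(* Compactness in near-covering form along the filter of large [M]: a bound that persists near each
   point becomes one bound on the whole cube. *)
move=> /(_ R (pinfty_nbhs R) (fun M x => enorm (Phi x) <= M)) [].
  move=> x _.
  have /continuous_enormP/(_ 1 ltr01)[s s0 Hs] := cPhi x.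
  have d0 : 0 < s / (d%:R + 1) by rewrite divr_gt0// ltr_wpDl.
  exists (ball x (s / (d%:R + 1)), [set M | enorm (Phi x) + 1 <= M]).
    split => /=; first exact: nbhsx_ballx.
    exists (enorm (Phi x) + 1); split; first exact: num_real.
    by move=> ? /ltW.
  move=> [y M] /= [xy HM] _.
  rewrite -[Phi y](subrK (Phi x)) (le_trans (ler_enormD _ _))//.
  rewrite (le_trans _ HM)// addrC lerD2l ltW// Hs//.
  rewrite enormB (le_lt_trans (ler_enorm_mx_norm _))//.
  move: xy; rewrite -ball_normE /= ltr_pdivlMr ?ltr_wpDl// => xy.
  by rewrite (le_lt_trans _ xy)// mulrC ler_wpM2l// lerDl.
move=> M0 [_ HM0]; pose M := Num.max (M0 + 1) 1.
have M0M : M0 < M by rewrite lt_max ltrDl ltr01.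
exists M; first by rewrite le_max ler01 orbT.
move=> x; have [xr|xr] := leP (enorm x) (`|r| + 1).
  apply: HM0 => // i; rewrite in_itv/= -ler_norml.
  by rewrite (le_trans (ler_coord_enorm _ _)).
rewrite le_max (ltW (Hr _ _)) ?orbT//.
by rewrite (le_lt_trans _ xr)// (le_trans (ler_norm _))// lerDl.
Qed.

Lemma C0field_unif_continuous Phi : C0field Phi -> forall e, 0 < e ->
  exists2 r, 0 < r & forall x y, enorm (y - x) < r -> enorm (Phi y - Phi x) < e.
Proof.
move=> [cPhi vPhi] e e0; have e2 : 0 < e / 2 by rewrite divr_gt0.
have [r Hr] := vPhi _ e2.
have /compact_near_coveringP/near_covering_withinP := compact_cube (`|r| + 1).
(* The same principle along the filter of small radii [s]. *)
move=> /(_ R (0^'+)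
  (fun s x => forall y, enorm (y - x) < s -> enorm (Phi y - Phi x) < e)) [].
  move=> x _.
  have /continuous_enormP/(_ _ e2)[s s0 Hs] := cPhi x.
  have d0 : 0 < s / 2 / (d%:R + 1) by rewrite !divr_gt0// ltr_wpDl.
  exists (ball x (s / 2 / (d%:R + 1)), [set M | M < s / 2]).
    split => /=; first exact: nbhsx_ballx.
    by apply: nbhs_right_lt; rewrite divr_gt0.
  move=> [y M] /= [xy HM] _ z yz.
  have yx : enorm (y - x) < s / 2.
    rewrite enormB (le_lt_trans (ler_enorm_mx_norm _))//.
    move: xy; rewrite -ball_normE /= ltr_pdivlMr ?ltr_wpDl// => xy.
    by rewrite (le_lt_trans _ xy)// mulrC ler_wpM2l// lerDl.
  have -> : Phi z - Phi y = (Phi z - Phi x) - (Phi y - Phi x).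
    by rewrite opprB addrC addrA subrK addrC.
  rewrite (le_lt_trans (ler_enormB _ _))// [ltRHS]splitr ltrD// Hs//.
    rewrite -[z](subrK y) -addrA (le_lt_trans (ler_enormD _ _))//.
    by rewrite [ltRHS]splitr ltrD// (lt_trans yz).
  by rewrite (lt_le_trans yx)// ler_pdivrMr// ler_peMr ?ler1n// ltW.
move=> M0 /= M00 HM0; pose M := Num.min (M0 / 2) 1.
have M0p : 0 < M by rewrite lt_min ltr01 divr_gt0.
exists M => //.
move=> x y; have [xr xy|xr] := leP (enorm x) (`|r| + 1).
  have := HM0 (M0 / 2); rewrite /ball_ /= sub0r normrN gtr0_norm ?divr_gt0//.
  rewrite ltr_pdivrMr// ltr_pMr// ltr1n => /(_ isT isT x) /=; apply.
    move=> i; rewrite in_itv/= -ler_norml.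
    by rewrite (le_trans (ler_coord_enorm _ _)).
  by rewrite (lt_le_trans xy)// ge_min lexx.
(* Since [|x| > |r| + 1] and [y] is within 1 of [x], both points lie where [Phi] is below
   [e / 2]. *)
rewrite lt_min => /andP[_ xy].
rewrite (le_lt_trans (ler_enormB _ _))// [ltRHS]splitr ltrD// Hr//.
  rewrite (le_lt_trans (ler_norm _))// -(ltrD2r 1) (lt_le_trans xr)//.
  rewrite -[leRHS](addrC 1) -lerBlDr (le_trans _ (ltW xy))//.
  rewrite lerBlDr enormB -{1}[x](subrK y); exact: ler_enormD.
by rewrite (le_lt_trans _ xr)// (le_trans (ler_norm _))// lerDl.
Qed.

Lemma C0fieldD Phi Psi : C0field Phi -> C0field Psi ->
  C0field (fun x => Phi x + Psi x).
Proof.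
move=> [c1 v1] [c2 v2]; split=> [x|e e0].
  by apply: continuousD; [exact: c1|exact: c2].
have e2 : 0 < e / 2 by rewrite divr_gt0.
have [r1 h1] := v1 _ e2; have [r2 h2] := v2 _ e2.
exists (Num.max r1 r2) => x; rewrite gt_max => /andP[/h1 ? /h2 ?].
by rewrite (le_lt_trans (ler_enormD _ _))// [ltRHS]splitr ltrD.
Qed.

Lemma C0fieldZ (a : R) Phi : C0field Phi -> C0field (fun x => a *: Phi x).
Proof.
move=> [c1 v1]; split=> [x|e e0].
  by apply: continuousZr; exact: c1.
have a1 : 0 < `|a| + 1 by rewrite ltr_wpDl.
have [r h] := v1 _ (divr_gt0 e0 a1).
exists r => x /h; rewrite enormZ ltr_pdivlMr// mulrC; apply: le_lt_trans.
by rewrite ler_wpM2r ?enorm_ge0// lerDl.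
Qed.

Lemma C0field_compact_support Phi (r : R) : continuous Phi ->
  (forall x, r < enorm x -> Phi x = 0) -> C0field Phi.
Proof.
by move=> cPhi h; split=> // e e0; exists r => x /h ->; rewrite enorm0.
Qed.

Lemma C0field0 : C0field (fun _ : 'rV[R]_d => 0 : 'rV[R]_d).
Proof. by apply: (@C0field_compact_support _ 0) => //; exact: cst_continuous. Qed.

Lemma C0fieldB Phi Psi : C0field Phi -> C0field Psi ->
  C0field (fun x => Phi x - Psi x).
Proof.
move=> h1 /(@C0fieldZ (- 1)) /(C0fieldD _ _ h1); congr C0field.
by apply/funext => x; rewrite scaleN1r.
Qed.

Lemma C0field_sum (I : finType) (Phi : I -> 'rV[R]_d -> 'rV[R]_d) :
  (forall i, C0field (Phi i)) -> C0field (fun x => \sum_i Phi i x).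
Proof.
move=> h; pose S (s : seq I) := fun x => \sum_(i <- s) Phi i x.
rewrite -[X in C0field X]/(S (index_enum I)).
elim: (index_enum I) => [|i s IH].
  by rewrite (_ : S _ = fun=> 0) ?funeqE /S; [exact: C0field0|move=> x; rewrite big_nil].
rewrite (_ : S _ = fun x => Phi i x + S s x); first exact: C0fieldD.
by rewrite funeqE /S => x; rewrite big_cons.
Qed.

Lemma supnorm_le Phi (M : R) : (forall x, enorm (Phi x) <= M) -> supnorm Phi <= M.
Proof.
by move=> h; apply: ge_sup; [exists (enorm (Phi 0)); exists 0|move=> _ [x _ <-]].
Qed.

Lemma le_supnorm Phi x : C0field Phi -> enorm (Phi x) <= supnorm Phi.
Proof.
move=> /C0field_bounded[M _ HM]; apply: ub_le_sup; last by exists x.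
by exists M => _ [y _ <-].
Qed.

Lemma supnorm_ge0 Phi : C0field Phi -> 0 <= supnorm Phi.
Proof. by move=> /(@le_supnorm _ 0); apply: le_trans; exact: enorm_ge0. Qed.

Variable F : ('rV[R]_d -> 'rV[R]_d) -> R.
Hypothesis mF : finite_vector_measure F.

Lemma measure_ext Phi Psi : Phi =1 Psi -> F Phi = F Psi.
Proof. by move=> h; congr F; exact/funext. Qed.

Lemma measureD Phi Psi : C0field Phi -> C0field Psi ->
  F (fun x => Phi x + Psi x) = F Phi + F Psi.
Proof. exact: mF.1. Qed.

Lemma measureZ a Phi : C0field Phi -> F (fun x => a *: Phi x) = a * F Phi.
Proof. exact: mF.2.1. Qed.

Lemma measureB Phi Psi : C0field Phi -> C0field Psi ->
  F (fun x => Phi x - Psi x) = F Phi - F Psi.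
Proof.
move=> h1 h2; rewrite -[F Psi]mul1r -mulNr -measureZ// -measureD//; last exact: C0fieldZ.
by apply: measure_ext => x; rewrite scaleN1r.
Qed.

Lemma measure0 : F (fun=> 0) = 0.
Proof.
rewrite -[RHS](mul0r (F (fun=> 0))) -measureZ; last exact: C0field0.
by apply: measure_ext => x; rewrite scaler0.
Qed.

Lemma measure_sum (I : finType) (Phi : I -> 'rV[R]_d -> 'rV[R]_d) :
  (forall i, C0field (Phi i)) -> F (fun x => \sum_i Phi i x) = \sum_i F (Phi i).
Proof.
move=> h; pose S (s : seq I) := fun x => \sum_(i <- s) Phi i x.
suff : C0field (S (index_enum I)) /\
  F (S (index_enum I)) = \sum_(i <- index_enum I) F (Phi i) by case.
elim: (index_enum I) => [|i s [IH1 IH2]].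
  rewrite (_ : S _ = fun=> 0); last by rewrite funeqE /S => x; rewrite big_nil.
  by rewrite measure0 big_nil; split; first exact: C0field0.
rewrite (_ : S _ = fun x => Phi i x + S s x).
  by rewrite measureD// IH2 big_cons; split; first exact: C0fieldD.
by rewrite funeqE /S => x; rewrite big_cons.
Qed.

Lemma mnorm_ub Phi : C0field Phi -> supnorm Phi <= 1 -> F Phi <= mnorm F.
Proof.
move=> cPhi h; apply: ub_le_sup; last by exists Phi.
have [_ [_ [M HM]]] := mF; exists `|M| => _ [Psi [cPsi Psi1] <-].
rewrite (le_trans (ler_norm _))// (le_trans (HM _ cPsi))//.
rewrite (le_trans (ler_norm _))// normrM (ger0_norm (supnorm_ge0 _ cPsi)).
by rewrite ler_piMr.
Qed.

Lemma mnorm_ge0 : 0 <= mnorm F.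
Proof.
rewrite -measure0 mnorm_ub//; first exact: C0field0.
by apply: supnorm_le => x; rewrite enorm0.
Qed.

Lemma measure_le Phi (M : R) : C0field Phi -> 0 < M ->
  (forall x, enorm (Phi x) <= M) -> F Phi <= mnorm F * M.
Proof.
move=> cPhi M0 h; rewrite -ler_pdivrMr// mulrC -measureZ//.
apply: mnorm_ub; first exact: C0fieldZ.
by apply: supnorm_le => x; rewrite enormZ gtr0_norm ?invr_gt0// mulrC ler_pdivrMr ?mul1r.
Qed.

Lemma measure_norm_le Phi (M : R) : C0field Phi -> 0 < M ->
  (forall x, enorm (Phi x) <= M) -> `|F Phi| <= mnorm F * M.
Proof.
move=> cPhi M0 h; rewrite ler_norml measure_le// andbT lerNl.
rewrite -[F Phi]mul1r -mulNr -measureZ//; apply: measure_le => //.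
  exact: C0fieldZ.
by move=> x; rewrite scaleN1r enormN.
Qed.

End C0fields.

(** * A smooth partition of unity *)

Section SmoothStep.
Context {R : realType}.
Implicit Types (x t : R) (k : nat).

(** The powers [x ^- k] make the family stable under differentiation, so that the flat function
    [exp (- 1 / x)], the case [k = 0], is handled together with all its derivatives. *)
Definition expinv k x : R := if 0 < x then x ^- k * expR (- x^-1) else 0.

Lemma expinv_ge0 k x : 0 <= expinv k x.
Proof.
rewrite /expinv; case: ifPn => // x0.
by rewrite mulr_ge0 ?expR_ge0// invr_ge0 exprn_ge0// ltW.
Qed.

(** Raise [y / (k + 1) <= exp (y / (k + 1))] to the power [k + 1] at [y = 1 / x]. The linear bound
    is what makes the derivative at 0 exist. *)
Lemma expinv_le k x : `|expinv k x| <= k.+1%:R ^+ k.+1 * `|x|.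
Proof.
rewrite /expinv; case: ifPn => [x0|_]; last by rewrite normr0 mulr_ge0.
rewrite !gtr0_norm ?mulr_gt0 ?expR_gt0 ?invr_gt0 ?exprn_gt0//.
have k0 : 0 < k.+1%:R :> R by [].
have H : (x^-1 / k.+1%:R) ^+ k.+1 <= expR (x^-1).
  rewrite -[X in expR X](divfK (lt0r_neq0 k0)) [X in expR X]mulrC expRM_natl.
  rewrite lerXn2r ?nnegrE ?expR_ge0// ?mulr_ge0 ?invr_ge0 ?(ltW x0)//.
  by rewrite (le_trans _ (expR_ge1Dx _))// lerDr.
rewrite expRN.
have e0 := expR_gt0 (x^-1).
have xk := exprn_gt0 k x0.
rewrite ler_pdivrMr// -[x ^- k]mul1r ler_pdivrMr//.
move: H; rewrite expr_div_n ler_pdivrMr ?exprn_gt0// exprVn.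
rewrite -(ler_pM2l (exprn_gt0 k.+1 x0)) mulfV ?gt_eqF ?exprn_gt0// => H.
rewrite (le_trans H)// exprSr le_eqVlt; apply/orP; left; apply/eqP; ring.
Qed.

Lemma is_derive_expinv k x : is_derive x 1 (expinv k)
  (expinv k.+2 x - k%:R * expinv k.+1 x).
Proof.
have [x0|x0|x0] := ltgtP x 0.
- apply: (near_eq_is_derive (f := cst 0)).
  + near=> y; rewrite /expinv ifF//; apply/negbTE; rewrite -leNgt ltW//.
    by near: y; exact: lt_nbhsl.
  + apply: is_derive_eq.
    by rewrite /expinv ifF ?ifF ?mulr0 ?subr0//; apply/negbTE; rewrite -leNgt ltW.
- apply: (near_eq_is_derive (V := R) (W := R)
    (f := fun y : R => (y ^+ k)^-1 * expR (- y^-1))).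
  + near=> y; rewrite /expinv ifT//.
    by near: y; exact: lt_nbhsr.
  + have xk : x ^+ k != 0 by rewrite expf_neq0// gt_eqF.
    have xn : x != 0 by rewrite gt_eqF.
    have d1 := is_deriveV (f := id) xn (is_derive_id x 1).
    have d2 := @is_derive1_comp _ expR (fun y : R => - y^-1) x _ _
      (is_derive_expR (- x^-1)) (is_deriveN d1).
    have d3 := is_deriveV (f := fun y : R => y ^+ k) xk
      (DeriveDef (@exprn_derivable R k x 1) (@exp_derive R k x 1)).
    apply: (is_derive_eq (is_deriveM d3 d2)).
    rewrite /expinv x0 /GRing.scale /=.
    case: (k) => [|k'] /=; first by field.
    by rewrite !exprS; field; rewrite xn expf_neq0.
- rewrite x0 /expinv !ltxx mulr0 subr0 -/(expinv k).
  (* At 0 the difference quotient of [expinv k] is [expinv k.+1], which tends to 0 by the linear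
     bound. *)
  have H : h^-1 *: (expinv k (h *: 1 + 0) - expinv k 0) @[h --> 0^'] --> (0 : R).
    apply/cvgrPdist_le => e e0.
    have c0 : 0 < k.+2%:R ^+ k.+2 :> R by rewrite exprn_gt0.
    near=> h; rewrite sub0r normrN /GRing.scale /= mulr1 addr0.
    rewrite {2}/expinv ltxx subr0.
    have -> : h^-1 * expinv k h = expinv k.+1 h.
      rewrite /expinv; case: ifPn => h0; last by rewrite mulr0.
      by rewrite exprS invfM mulrA.
    rewrite (le_trans (expinv_le _ _))// mulrC -ler_pdivlMr//.
    near: h; apply: nbhs_dnbhs; apply/nbhs_ballP; exists (e / k.+2%:R ^+ k.+2) => /=.
      by rewrite divr_gt0.
    by move=> y; rewrite /ball /= sub0r normrN => /ltW.
  split; first by apply/cvg_ex; exists 0.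
  exact: (cvg_lim _ H).
Unshelve. all: by end_near. Qed.

Lemma expinv0_gt0 x : 0 < x -> 0 < expinv 0 x.
Proof. by move=> x0; rewrite /expinv x0 expr0 invr1 mul1r expR_gt0. Qed.

Lemma expinv0_le0 x : x <= 0 -> expinv 0 x = 0.
Proof. by rewrite leNgt /expinv => /negbTE ->. Qed.

Lemma expinv0_nondecreasing x t : x <= t -> expinv 0 x <= expinv 0 t.
Proof.
move=> xt; rewrite {1}/expinv; case: ifPn => x0; last exact: expinv_ge0.
have t0 := lt_le_trans x0 xt.
rewrite /expinv t0 !expr0 !invr1 !mul1r ler_expR lerN2.
by rewrite lef_pV2 ?posrE.
Qed.

Definition smooth_step t : R := expinv 0 t / (expinv 0 t + expinv 0 (1 - t)).

Lemma smooth_step_den_gt0 t : 0 < expinv 0 t + expinv 0 (1 - t).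
Proof.
have [t0|t0] := ltP 0 t.
  by rewrite ltr_wpDr ?expinv_ge0// expinv0_gt0.
by rewrite ltr_wpDl ?expinv_ge0// expinv0_gt0// subr_gt0 (le_lt_trans t0).
Qed.

Lemma smooth_step_le0 t : t <= 0 -> smooth_step t = 0.
Proof. by move=> t0; rewrite /smooth_step expinv0_le0// mul0r. Qed.

Lemma smooth_step_ge1 t : 1 <= t -> smooth_step t = 1.
Proof.
move=> t1; rewrite /smooth_step (expinv0_le0 (1 - t)) ?subr_le0// addr0 divff//.
by rewrite gt_eqF// expinv0_gt0// (lt_le_trans ltr01).
Qed.

Lemma smooth_step_le1 t : smooth_step t <= 1.
Proof. by rewrite ler_pdivrMr ?smooth_step_den_gt0// mul1r lerDl expinv_ge0. Qed.

Lemma smooth_step_nondecreasing x t : x <= t -> smooth_step x <= smooth_step t.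
Proof.
move=> xt; rewrite /smooth_step ler_pdivrMr ?smooth_step_den_gt0//.
rewrite mulrAC ler_pdivlMr ?smooth_step_den_gt0//.
have h1 := expinv0_nondecreasing _ _ xt.
have h2 : expinv 0 (1 - t) <= expinv 0 (1 - x).
  by rewrite expinv0_nondecreasing// lerB.
rewrite !mulrDr (mulrC (expinv 0 t)) lerD2l ler_pM ?expinv_ge0//.
Qed.

(** A difference of two unit translates of one step, so that sums of translates telescope. *)
Definition hat t : R := smooth_step (t + 1) - smooth_step t.

Lemma hat_ge0 t : 0 <= hat t.
Proof. by rewrite subr_ge0 smooth_step_nondecreasing// lerDl. Qed.

Lemma hat_eq0 t : 1 <= `|t| -> hat t = 0.
Proof.
rewrite /hat ler_normr => /orP[t1|t1].
  by rewrite !smooth_step_ge1 ?subrr// (le_trans t1)// lerDl.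
by rewrite !smooth_step_le0 ?subrr//; lra.
Qed.

(** Telescoping with stride [n]: a sum over [K + n] terms can be cut after [K] or after [n] terms.
    Only [n] leading and [n] trailing terms survive. *)
Lemma sum_telescope (V : zmodType) (s : nat -> V) (K n : nat) :
  \sum_(k < K) (s k - s (k + n)%N) = \sum_(k < n) (s k - s (k + K)%N).
Proof.
rewrite !sumrB; apply/eqP; rewrite subr_eq addrAC eq_sym subr_eq; apply/eqP.
have H a b : \sum_(k < a) s k + \sum_(k < b) s (k + a)%N = \sum_(k < a + b) s k.
  by rewrite big_split_ord /=; congr (_ + _); apply: eq_bigr => i _; rewrite addnC.
by rewrite !H addnC.
Qed.

Lemma sum_hatE (n m : nat) t : (0 < n)%N ->
  \sum_(k < (2 * (m * n)).+1) hat (t - (k%:R - (m * n)%:R) / n%:R) =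
  \sum_(k < n) (smooth_step (t + m%:R + 1 - k%:R / n%:R) -
    smooth_step (t + m%:R + 1 - (k + (2 * (m * n)).+1)%:R / n%:R)).
Proof.
move=> n0; have nR : n%:R != 0 :> R by rewrite pnatr_eq0 -lt0n.
rewrite -(sum_telescope _ (fun k => smooth_step (t + m%:R + 1 - k%:R / n%:R))).
apply: eq_bigr => k _; rewrite /hat natrD natrM.
by congr (smooth_step _ - smooth_step _); field.
Qed.

Lemma sum_hat_le (n m : nat) t : (0 < n)%N ->
  \sum_(k < (2 * (m * n)).+1) hat (t - (k%:R - (m * n)%:R) / n%:R) <= n%:R.
Proof.
move=> n0; rewrite sum_hatE//.
apply: (@le_trans _ _ (\sum_(k < n) 1)); last by rewrite sumr_const card_ord.
apply: ler_sum => k _; rewrite lerBlDr.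
rewrite (le_trans (smooth_step_le1 _))// lerDl.
by rewrite divr_ge0 ?expinv_ge0// ltW// smooth_step_den_gt0.
Qed.

(** In this range of [t] the [n] leading steps that survive are all 1 and the [n] trailing ones all
    0. *)
Lemma sum_hat (n m : nat) t : (0 < n)%N -> `|t| <= m%:R - 1 ->
  \sum_(k < (2 * (m * n)).+1) hat (t - (k%:R - (m * n)%:R) / n%:R) = n%:R.
Proof.
move=> n0; rewrite ler_norml => /andP[t1 t2]; rewrite sum_hatE//.
have nR : 0 < n%:R :> R by rewrite ltr0n.
rewrite (eq_bigr (fun=> 1)) ?sumr_const ?card_ord// => k _.
rewrite smooth_step_ge1 ?smooth_step_le0 ?subr0//.
  rewrite subr_le0 ler_pdivlMr// natrD -natr1 !natrM.
  have k0 : 0 <= k%:R :> R by [].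
  by nra.
have k1 : k%:R / n%:R <= 1 :> R.
  by rewrite ler_pdivrMr// mul1r ler_nat ltnW.
lra.
Qed.

End SmoothStep.

(** * Smooth functions from a class stable under differentiation *)

Section Elementary.
Context {R : realType} {d : nat}.
Implicit Types (f g : 'rV[R]_d -> R) (v x : 'rV[R]_d).

(* A class of functions closed under every directional derivative, so that its
   members are smooth. *)
Inductive elementary : ('rV[R]_d -> R) -> Prop :=
| elementary_cst (c : R) : elementary (fun=> c)
| elementary_coord i : elementary (fun x => x ord0 i)
| elementaryD f g : elementary f -> elementary g -> elementary (fun x => f x + g x)
| elementaryM f g : elementary f -> elementary g -> elementary (fun x => f x * g x)
| elementaryV f : (forall x, f x != 0) -> elementary f -> elementary (fun x => (f x)^-1)
| elementary_expinv k f : elementary f -> elementary (fun x => expinv k (f x)).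

Lemma elementary_differentiable f : elementary f -> forall x, differentiable f x.
Proof.
elim=> {f} [c|i|f g _ IHf _ IHg|f g _ IHf _ IHg|f f0 _ IH|k f _ IH] x.
- exact: differentiable_cst.
- exact: differentiable_coord.
- exact: differentiableD.
- exact: differentiableM.
- exact: differentiableV.
- apply: (@differentiable_comp _ _ _ _ f (expinv k)) => //.
  by apply/derivable1_diffP; case: (is_derive_expinv k (f x)).
Qed.

Lemma derive_coord i v x : 'D_v (fun y : 'rV[R]_d => y ord0 i) x = v ord0 i.
Proof.
have := @derive_mx R 'rV[R]_d 1 d id x v (@derivable_id _ _ x v).
by rewrite derive_id => /matrixP/(_ ord0 i); rewrite mxE => ->.
Qed.

Lemma elementary_ext g f : f =1 g -> elementary g -> elementary f.
Proof. by move=> /funext ->. Qed.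

Lemma elementary_derive f v : elementary f -> elementary (fun x => 'D_v f x).
Proof.
elim=> {f} [c|i|f g Ef IHf Eg IHg|f g Ef IHf Eg IHg|f f0 Ef IH|k f Ef IH].
- apply: (elementary_ext (fun=> 0)); last exact: elementary_cst.
  by move=> x; rewrite derive_cst.
- apply: (elementary_ext (fun=> v ord0 i)); last exact: elementary_cst.
  by move=> x; rewrite derive_coord.
- apply: (elementary_ext (fun x => 'D_v f x + 'D_v g x)); last exact: elementaryD.
  by move=> x; rewrite deriveD//; apply: diff_derivable;
    exact: elementary_differentiable.
- apply: (elementary_ext (fun x => f x * 'D_v g x + g x * 'D_v f x)); last first.
    by apply: elementaryD; exact: elementaryM.
  by move=> x; rewrite deriveM//; apply: diff_derivable;
    exact: elementary_differentiable.
- apply: (elementary_ext (fun x => -1 * ((f x)^-1 * (f x)^-1) * 'D_v f x)); last first.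
    apply: elementaryM => //; apply: elementaryM; first exact: elementary_cst.
    by apply: elementaryM; exact: elementaryV.
  move=> x; rewrite deriveV//; last first.
    by apply: diff_derivable; exact: elementary_differentiable.
  by rewrite mulN1r -exprVn expr2.
- apply: (elementary_ext (fun x =>
      (expinv k.+2 (f x) + -1 * (k%:R * expinv k.+1 (f x))) * 'D_v f x)); last first.
    apply: elementaryM => //; apply: elementaryD; first exact: elementary_expinv.
    apply: elementaryM; first exact: elementary_cst.
    by apply: elementaryM; [exact: elementary_cst|exact: elementary_expinv].
  move=> x; have df := elementary_differentiable _ Ef x.
  have dk : differentiable (expinv k) (f x).
    by apply/derivable1_diffP; case: (is_derive_expinv k (f x)).
  rewrite deriveE; last exact: (@differentiable_comp _ _ _ _ f (expinv k)).
  rewrite (diff_comp df dk) /= -(deriveE _ df) diff1E// derive1E.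
  rewrite (@derive_val _ _ _ _ _ _ _ (is_derive_expinv k (f x))).
  by rewrite /GRing.scale /= mulN1r mulrC.
Qed.

Lemma elementary_smooth f : elementary f -> smooth f.
Proof.
move=> Ef vs; suff : elementary (iter_dir vs f) by exact: elementary_differentiable.
by elim: vs => //= v vs IH; exact: elementary_derive.
Qed.

Lemma elementary_sum (I : finType) (f : I -> 'rV[R]_d -> R) :
  (forall i, elementary (f i)) -> elementary (fun x => \sum_i f i x).
Proof.
move=> Ef; elim: (index_enum I) => [|i s IH].
  rewrite (_ : (fun x => _) = fun=> 0); first exact: elementary_cst.
  by apply/funext => x; rewrite big_nil.
rewrite (_ : (fun x => _) = fun x => f i x + \sum_(j <- s) f j x).
  exact: elementaryD.
by apply/funext => x; rewrite big_cons.
Qed.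

Lemma elementary_prod (I : finType) (f : I -> 'rV[R]_d -> R) :
  (forall i, elementary (f i)) -> elementary (fun x => \prod_i f i x).
Proof.
move=> Ef; elim: (index_enum I) => [|i s IH].
  rewrite (_ : (fun x => _) = fun=> 1); first exact: elementary_cst.
  by apply/funext => x; rewrite big_nil.
rewrite (_ : (fun x => _) = fun x => f i x * \prod_(j <- s) f j x).
  exact: elementaryM.
by apply/funext => x; rewrite big_cons.
Qed.

Lemma elementary_hat f : elementary f -> elementary (fun x => hat (f x)).
Proof.
have step g : elementary g -> elementary (fun x => smooth_step (g x)).
  move=> Eg; rewrite /smooth_step; apply: elementaryM.
    exact: elementary_expinv.
  apply: elementaryV; first by move=> x; rewrite gt_eqF// smooth_step_den_gt0.
  apply: elementaryD; apply: elementary_expinv => //.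
  apply: elementaryD; first exact: elementary_cst.
  rewrite (_ : (fun x => _) = fun x => -1 * g x).
    by apply: elementaryM => //; exact: elementary_cst.
  by apply/funext => x; rewrite mulN1r.
move=> Ef; rewrite (_ : (fun x => _) = fun x =>
    smooth_step (f x + 1) + -1 * smooth_step (f x)).
  apply: elementaryD; first by apply/step/elementaryD => //; exact: elementary_cst.
  by apply: elementaryM; [exact: elementary_cst|exact: step].
by apply/funext => x; rewrite mulN1r.
Qed.

End Elementary.

(** * Gradients and first-order expansions *)

Section Gradient.
Context {R : realType} {d : nat}.
Implicit Types (f : 'rV[R]_d -> R) (v x y z : 'rV[R]_d).

Lemma derive_grad f x v : differentiable f x -> 'D_v f x = dotv (grad f x) v.
Proof.
move=> df; rewrite deriveE// {1}(row_sum_evec v) linear_sum /dotv.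
apply: eq_bigr => j _; rewrite linearZ /= -deriveE// mxE mulrC.
by [].
Qed.

Lemma derive_translate f c v x : 'D_v (fun y => f (y - c)) x = 'D_v f (x - c).
Proof.
rewrite /derive; apply: (congr1 (fun g : R -> R => lim (g @ 0^'))).
by apply/funext => h /=; rewrite addrA.
Qed.

Lemma grad_translate f c x : grad (fun y => f (y - c)) x = grad f (x - c).
Proof. by apply/rowP => j; rewrite !mxE derive_translate. Qed.

Lemma is_derive_line f p z (s : R) : (forall x, differentiable f x) ->
  is_derive s 1 (fun t : R => f (p + t *: z)) (dotv (grad f (p + s *: z)) z).
Proof.
move=> df; have E : (fun h : R => h^-1 *: (((fun t : R => f (p + t *: z)) \o shift s)
    (h *: 1) - f (p + s *: z))) =
    (fun h : R => h^-1 *: ((f \o shift (p + s *: z)) (h *: z) - f (p + s *: z))).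
  apply/funext => h /=; congr (_ *: (f _ - _)).
  by rewrite scalerDl addrCA /GRing.scale /= mulr1.
split.
  have H : derivable f (p + s *: z) z by exact: diff_derivable.
  by move: H; rewrite /derivable -E.
by rewrite -derive_grad// /derive; exact: (congr1 (fun g : R -> R => lim (g @ 0^')) E).
Qed.

(** By the mean value theorem on the segment the increment is a gradient at an intermediate point,
    so the error is the oscillation of the gradient. *)
Lemma grad_taylor f p z (e : R) : (forall x, differentiable f x) ->
  (forall s, 0 <= s <= 1 -> enorm (grad f (p + s *: z) - grad f p) <= e) ->
  `|f (p + z) - f p - dotv (grad f p) z| <= e * enorm z.
Proof.
move=> df H.
have dg s := is_derive_line f p z s df.
have Hc : {within `[0, 1], continuous (fun t : R => f (p + t *: z))}.
  apply: continuous_subspaceT => s.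
  by apply/differentiable_continuous/derivable1_diffP; case: (dg s).
have [c c01] := MVT_segment ler01 (fun s _ => dg s) Hc.
rewrite scale1r scale0r addr0 subr0 mulr1 => ->.
rewrite -dotvNl -dotvDl (le_trans (ler_norm_dotv _ _))//.
by rewrite ler_wpM2r ?enorm_ge0// H//; move: c01; rewrite in_itv.
Qed.

Lemma near_enorm_gt x (r : R) : r < enorm x -> \near x, r < enorm x.
Proof.
move=> rx; apply/nbhs_ballP; exists ((enorm x - r) / (d%:R + 1)) => /=.
  by rewrite divr_gt0 ?subr_gt0// ltr_wpDl.
have d1 : 0 < d%:R + 1 :> R by rewrite ltr_wpDl.
move=> y; rewrite -ball_normE /= ltr_pdivlMr// => xy.
have h : enorm (x - y) < enorm x - r.
  rewrite (le_lt_trans _ xy)// (le_trans (ler_enorm_mx_norm _))// mulrC.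
  by rewrite ler_wpM2l// lerDl.
have := ler_enormD (x - y) y; rewrite subrK; lra.
Qed.

Lemma derive_out f v (r : R) : (forall x, r < enorm x -> f x = 0) ->
  forall x, r < enorm x -> 'D_v f x = 0.
Proof.
move=> h x rx; rewrite -(derive_cst (0 : R) x v); apply: near_eq_derive.
by near=> y; apply: h; near: y; exact: near_enorm_gt.
Unshelve. all: by end_near. Qed.

Lemma C0field_scal f v (r : R) : continuous f ->
  (forall x, r < enorm x -> f x = 0) -> C0field (fun x => f x *: v).
Proof.
move=> cf h; apply: (@C0field_compact_support _ _ _ r).
  by move=> x; apply: continuousZl; exact: cf.
by move=> x /h ->; rewrite scale0r.
Qed.

Lemma C0field_grad f (r : R) : elementary f ->
  (forall x, r < enorm x -> f x = 0) -> C0field (grad f).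
Proof.
move=> Ef h; rewrite (_ : grad f = fun x => \sum_j ('D_(evec j) f x *: evec j)).
  apply: C0field_sum => j; apply: (@C0field_scal _ _ r).
    by move=> x; apply/differentiable_continuous/elementary_differentiable/elementary_derive.
  exact: derive_out.
apply/funext => x; rewrite {1}(row_sum_evec (grad f x)).
by apply: eq_bigr => j _; rewrite mxE.
Qed.

Lemma derive_lincomb (I : finType) (c : I -> R) (f : I -> 'rV[R]_d -> R) v x :
  (forall i, elementary (f i)) ->
  'D_v (fun y => \sum_i c i * f i y) x = \sum_i c i * 'D_v (f i) x.
Proof.
move=> Ef.
suff : elementary (fun y => \sum_i c i * f i y) /\
  'D_v (fun y => \sum_i c i * f i y) x = \sum_i c i * 'D_v (f i) x by case.
elim: (index_enum I) => [|i s [E IH]].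
  rewrite (_ : (fun y => _) = fun=> 0); last by apply/funext => y; rewrite big_nil.
  by rewrite big_nil derive_cst; split; first exact: elementary_cst.
rewrite (_ : (fun y => _) = fun y => c i * f i y + \sum_(j <- s) c j * f j y); last first.
  by apply/funext => y; rewrite big_cons.
have Ei : elementary (fun y => c i * f i y).
  by apply: elementaryM => //; exact: elementary_cst.
split; first exact: elementaryD.
have D g : elementary g -> derivable g x v.
  by move=> Eg; apply/diff_derivable/elementary_differentiable.
rewrite [LHS](deriveD (D _ Ei) (D _ E)) IH big_cons; congr (_ + _).
by rewrite [LHS](deriveZ (c i) (D _ (Ef i))).
Qed.

Lemma grad_lincomb (I : finType) (c : I -> R) (f : I -> 'rV[R]_d -> R) x :
  (forall i, elementary (f i)) ->
  grad (fun y => \sum_i c i * f i y) x = \sum_i c i *: grad (f i) x.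
Proof.
move=> Ef; apply/rowP => j; rewrite mxE derive_lincomb// summxE.
by apply: eq_bigr => i _; rewrite !mxE.
Qed.

End Gradient.

(** * Grids, sums of bumps and translations of the grid *)

Section Grid.
Context {R : realType} {d : nat}.
Implicit Types (x y z : 'rV[R]_d) (e h : R).

Definition gridpt h (N : nat) (k : {ffun 'I_d -> 'I_(2 * N).+1}) : 'rV[R]_d :=
  \row_j (h * ((k j)%:R - N%:R)).

Definition bump e x : R := \prod_j hat (x ord0 j / e).

Lemma bump_ge0 e x : 0 <= bump e x.
Proof. by apply: prodr_ge0 => j _; exact: hat_ge0. Qed.

Lemma bump_eq0 e x j : 0 < e -> e <= `|x ord0 j| -> bump e x = 0.
Proof.
move=> e0 xj; rewrite /bump (bigD1 j)//= hat_eq0 ?mul0r//.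
by rewrite normrM normfV (gtr0_norm e0) ler_pdivlMr// mul1r.
Qed.

Lemma bump_neq0 e x : 0 < e -> bump e x != 0 -> forall j, `|x ord0 j| < e.
Proof. by move=> e0 /eqP h j; rewrite ltNge; apply/negP => /bump_eq0; auto. Qed.

Lemma bump_out e x : 0 < e -> d%:R * e < enorm x -> bump e x = 0.
Proof.
move=> e0 H; apply/eqP/negPn/negP => /(bump_neq0 _ _ e0) h; move: H; apply/negP.
by rewrite -leNgt; apply: ler_enorm_coord => j; exact/ltW/h.
Qed.

Lemma elementary_bump e c : elementary (fun x => bump e (x - c)).
Proof.
apply: elementary_prod => j; apply: elementary_hat.
apply: (elementary_ext (fun x => (x ord0 j + - c ord0 j) * e^-1)).
  by move=> x; rewrite !mxE.
apply: elementaryM; last exact: elementary_cst.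
by apply: elementaryD; [exact: elementary_coord|exact: elementary_cst].
Qed.

(** Nodes and bumps are products over the coordinates, so the sum distributes. With mesh [e / n]
    each axis contributes [n], whence the total [n ^ d] by which grid sums are normalised. *)
Lemma sum_bumpE e (n m : nat) x : 0 < e -> (0 < n)%N ->
  \sum_k bump e (x - gridpt (e / n%:R) (m * n) k) =
  \prod_(j < d) \sum_(k < (2 * (m * n)).+1)
     hat (x ord0 j / e - (k%:R - (m * n)%:R) / n%:R).
Proof.
move=> e0 n0; rewrite bigA_distr_bigA /=.
apply: eq_bigr => k _; apply: eq_bigr => j _; congr hat; rewrite !mxE.
have nR : n%:R != 0 :> R by rewrite pnatr_eq0 -lt0n.
have eR : e != 0 by rewrite gt_eqF.
by field; rewrite ?nR ?eR.
Qed.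

Lemma sum_bump_le e (n m : nat) x : 0 < e -> (0 < n)%N ->
  \sum_k bump e (x - gridpt (e / n%:R) (m * n) k) <= n%:R ^+ d.
Proof.
move=> e0 n0; rewrite sum_bumpE//.
rewrite -[d in leRHS]card_ord -prodr_const; apply: ler_prod => j _.
rewrite sum_hat_le// andbT.
by apply: sumr_ge0 => k _; exact: hat_ge0.
Qed.

Lemma sum_bump e (n m : nat) x : 0 < e -> (0 < n)%N ->
  (forall j, `|x ord0 j| <= (m%:R - 1) * e) ->
  \sum_k bump e (x - gridpt (e / n%:R) (m * n) k) = n%:R ^+ d.
Proof.
move=> e0 n0 hx; rewrite sum_bumpE//.
rewrite -[d in RHS]card_ord -prodr_const; apply: eq_bigr => j _.
apply: sum_hat => //.
by rewrite normrM normfV (gtr0_norm e0) ler_pdivrMr.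
Qed.

(* Grid translations are made cyclic in order to be bijections; wrapping around is harmless
   for summands vanishing near the boundary of the grid. *)
Definition cyc (N : nat) (w : int) (k : 'I_(2 * N).+1) : 'I_(2 * N).+1 :=
  inord (let s := (k%:Z + w)%R in
    if (s < 0)%R then absz (s + (2 * N).+1%:Z)%R
    else if (s <= (2 * N)%:Z)%R then absz s else absz (s - (2 * N).+1%:Z)%R).

Lemma cycP (N : nat) (w : int) (k : 'I_(2 * N).+1) : (absz w <= N)%N ->
  [\/ (cyc N w k)%:Z = (k%:Z + w)%R,
     (k%:Z + w < 0)%R /\ (cyc N w k)%:Z = (k%:Z + w + (2 * N).+1%:Z)%R |
     (k%:Z + w > (2 * N)%:Z)%R /\ (cyc N w k)%:Z = (k%:Z + w - (2 * N).+1%:Z)%R].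
Proof.
move=> wN; have kN := ltn_ord k; rewrite /cyc /=.
case: ifPn => s0; [|case: ifPn => s1]; rewrite inordK; try lia.
- by apply: Or32; split; lia.
- by apply: Or31; lia.
- by apply: Or33; split; lia.
Qed.

Lemma cycK (N : nat) (w : int) : (absz w <= N)%N -> cancel (cyc N w) (cyc N (- w)).
Proof.
move=> wN k; apply: val_inj => /=; have kN := ltn_ord k.
have kN' := ltn_ord (cyc N (- w) (cyc N w k)).
have wN' : (absz (- w)%R <= N)%N by lia.
by case: (cycP _ _ k wN) => [E1|[? E1]|[? E1]];
  case: (cycP _ _ (cyc N w k) wN') => [E2|[? E2]|[? E2]]; lia.
Qed.

Lemma grid_shift h (N : nat) (w : 'I_d -> int) (b : R) (G : 'rV[R]_d -> R) :
  0 < h -> 0 <= b -> b + 1 <= h * N%:R -> (forall j, h * `|w j|%:~R <= 1) ->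
  (forall x j, b < `|x ord0 j| -> G x = 0) ->
  \sum_k G (gridpt h N k + \row_j (h * (w j)%:~R)) = \sum_k G (gridpt h N k).
Proof.
move=> h0 b0 bN w1 GO.
have wN j : (absz (w j) <= N)%N.
  rewrite -(ler_nat R) -(ler_pM2l h0).
  have -> : (absz (w j))%:R = `|w j|%:~R :> R by rewrite -abszE.
  by rewrite (le_trans (w1 j))//; lra.
have NE : (2 * N).+1%:R = 2 * N%:R + 1 :> R by rewrite -addn1 natrD natrM.
pose s (k : {ffun 'I_d -> 'I_(2 * N).+1}) := [ffun j => cyc N (w j) (k j)].
have sI : injective s.
  move=> k1 k2 /ffunP E; apply/ffunP => j; have := E j; rewrite !ffunE.
  exact: (can_inj (cycK _ _ (wN j))).
rewrite [RHS](reindex_inj sI) /=; apply: eq_bigr => k _.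
have [E|/existsP[j]] := boolP [forall j, (s k j)%:Z == (k j)%:Z + w j].
  congr G; apply/rowP => j; rewrite !mxE -mulrDr; congr (_ * _).
  have /eqP := forallP E j => /(congr1 (fun z : int => z%:~R : R)).
  by rewrite rmorphD /= -!pmulrn => ->; rewrite addrAC.
set K : R := (k j)%:R; set W : R := (w j)%:~R.
have hW : -1 <= h * W <= 1.
  rewrite -ler_norml normrM (gtr0_norm h0) (le_trans _ (w1 j))//.
  by rewrite ler_pM2l// /W intr_norm.
have hK : 0 <= h * K by rewrite mulr_ge0// ltW.
have hK2 : h * K <= 2 * (h * N%:R).
  rewrite mulrCA ler_pM2l// /K -natrM ler_nat; exact: (ltn_ord (k j)).
(* Where the shift wraps around, the translated node and the node replacing it both have their
   [j]-th coordinate beyond [b]: the grid has a margin of 1 and the shift is at most 1 in each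
   coordinate. Hence [G] vanishes at both. *)
have H0 : b < `|(gridpt h N k + \row_j0 (h * (w j0)%:~R)) ord0 j| ->
    b < `|gridpt h N (s k) ord0 j| ->
    G (gridpt h N k + \row_j0 (h * (w j0)%:~R)) = G (gridpt h N (s k)).
  by move=> /GO -> /GO ->.
have := cycP _ _ (k j) (wN j); rewrite /s ffunE => -[->|[H1 H2] _|[H1 H2] _].
- by rewrite eqxx.
- have h1 : h * K + h * W + h <= 0.
    have : (k j)%:Z + w j + 1 <= 0 by lia.
    by rewrite -(ler_int R) !rmorphD /= -pmulrn -/K -/W -(ler_pM2l h0) !mulrDr mulr0 mulr1.
  have h2 : (cyc N (w j) (k j))%:R = K + W + 2 * N%:R + 1 :> R.
    have /(congr1 (fun z : int => z%:~R : R)) := H2.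
    by rewrite !rmorphD /= -!pmulrn NE addrA.
  by apply: H0; rewrite !mxE ?ffunE ?h2 -/K -/W ltr_normr; apply/orP; [right|left]; lra.
- have h1 : h * K + h * W >= 2 * (h * N%:R) + h.
    have : (k j)%:Z + w j >= 2 * N%:Z + 1 by lia.
    rewrite -(ler_int R) !rmorphD rmorphM /= -!pmulrn -/K -/W.
    by rewrite -(ler_pM2l h0) !mulrDr mulr1 mulrCA.
  have h2 : (cyc N (w j) (k j))%:R = K + W - (2 * N%:R + 1) :> R.
    have /(congr1 (fun z : int => z%:~R : R)) := H2.
    by rewrite !rmorphD rmorphN /= -!pmulrn NE.
  by apply: H0; rewrite !mxE ?ffunE ?h2 -/K -/W ltr_normr; apply/orP; [left|right]; lra.
Qed.

End Grid.

(** * Mollification by grid sums *)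

Section Smoothing.
Context {R : realType} {d : nat}.
Implicit Types (x y z p q : 'rV[R]_d) (e h t : R) (u : 'rV[R]_d -> R).

(** A Riemann sum for the convolution of [u] with a bump of width [e], normalised by the total
    weight [n ^ d] of the bumps at a point. As a finite combination of bumps it is elementary, and
    only point values of [u] enter. *)
Definition gridconv e (n m : nat) u x : R :=
  \sum_k (u (gridpt (e / n%:R) (m * n) k) / n%:R ^+ d) *
    bump e (x - gridpt (e / n%:R) (m * n) k).

Lemma elementary_gridconv e (n m : nat) u : elementary (gridconv e n m u).
Proof.
apply: elementary_sum => k; apply: elementaryM; first exact: elementary_cst.
exact: elementary_bump.
Qed.

Lemma elementary_bump0 e : elementary (bump e : 'rV[R]_d -> R).
Proof.
by apply: (elementary_ext (fun x => bump e (x - 0))) (elementary_bump _ _) => x;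
  rewrite subr0.
Qed.

Lemma grad_gridconv e (n m : nat) u x : grad (gridconv e n m u) x =
  \sum_k (u (gridpt (e / n%:R) (m * n) k) / n%:R ^+ d) *:
    grad (bump e) (x - gridpt (e / n%:R) (m * n) k).
Proof.
rewrite [LHS]grad_lincomb; last by move=> k; exact: elementary_bump.
by apply: eq_bigr => k _; rewrite (grad_translate (bump e)).
Qed.

(** There are [(2 m n + 1) ^ d] nodes of weight at most [B / n ^ d], so the constant does not depend
    on [n]: the size of the increments can be fixed before the grid is refined. *)
Lemma gridconv_taylor e (n m : nat) u x z (B e' : R) : (0 < n)%N ->
  (forall x, `|u x| <= B) ->
  (forall p q, enorm (q - p) <= enorm z ->
     enorm (grad (bump e) q - grad (bump e) p) <= e') ->
  `|gridconv e n m u (x + z) - gridconv e n m u x - dotv (grad (gridconv e n m u) x) z|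
    <= (2 * m + 1)%:R ^+ d * B * e' * enorm z.
Proof.
move=> n0 uB H; pose pt := @gridpt R d (e / n%:R) (m * n).
have B0 : 0 <= B by exact: le_trans (uB 0).
have e'0 : 0 <= e'.
  by apply: le_trans (H 0 0 _); rewrite subrr enorm0 ?enorm_ge0.
have nd : 0 < n%:R ^+ d :> R by rewrite exprn_gt0// ltr0n.
rewrite grad_gridconv dotv_suml /gridconv -!sumrB.
rewrite (le_trans (ler_norm_sum _ _ _))//.
apply: (@le_trans _ _ (\sum_(k : {ffun 'I_d -> 'I_(2 * (m * n)).+1})
   (B / n%:R ^+ d) * (e' * enorm z))).
  apply: ler_sum => k _; rewrite -/pt -!mulrBr normrM ler_pM//.
    by rewrite normrM normfV (gtr0_norm nd) ler_wpM2r ?invr_ge0 ?(ltW nd).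
  have -> : x + z - pt k = x - pt k + z by rewrite addrAC.
  apply: grad_taylor; first by apply: elementary_differentiable; exact: elementary_bump0.
  move=> s /andP[s0 s1]; apply: H; rewrite addrC addKr enormZ ger0_norm//.
  by rewrite ler_piMl ?enorm_ge0.
rewrite sumr_const card_ffun !card_ord -[leLHS]mulr_natl natrX.
rewrite !mulrA ler_wpM2r ?enorm_ge0// ler_wpM2r// -mulrA mulrCA mulrC -!mulrA.
rewrite mulrA ler_wpM2r// ler_pdivrMr// -exprMn -natrM.
rewrite lerXn2r ?nnegrE// ler_nat; nia.
Qed.

(** Moving the nodes along with [x] transfers the increment from the bump to [u]; an inequality for
    the increments of [u] can then be used node by node. *)
Lemma gridconv_shift e (n m : nat) u x (b : R) (w : 'I_d -> int) :
  let z := \row_j (e / n%:R * (w j)%:~R) in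
  0 < e -> (0 < n)%N -> 0 <= b -> b + 1 <= e * m%:R ->
  (forall x j, b < `|x ord0 j| -> u x = 0) ->
  (forall j, e / n%:R * `|w j|%:~R <= 1) ->
  gridconv e n m u (x + z) - gridconv e n m u x =
  \sum_k ((u (gridpt (e / n%:R) (m * n) k + z) - u (gridpt (e / n%:R) (m * n) k))
      / n%:R ^+ d) * bump e (x - gridpt (e / n%:R) (m * n) k).
Proof.
move=> z e0 n0 b0 bm ub w1; have nR : 0 < n%:R :> R by rewrite ltr0n.
have hm : b + 1 <= e / n%:R * (m * n)%:R.
  by rewrite natrM (mulrC m%:R) mulrA divfK ?gt_eqF.
have := @grid_shift R d (e / n%:R) (m * n) w b
  (fun p => u p / n%:R ^+ d * bump e (x + z - p)) (divr_gt0 e0 nR) b0 hm w1.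
move=> /=; rewrite -/z => GS.
rewrite /gridconv -GS; last by move=> y j /ub ->; rewrite !mul0r.
rewrite -sumrB; apply: eq_bigr => k _.
by rewrite opprD addrACA subrr addr0 -!mulrBl.
Qed.

(** The weights are nonnegative and add up to 1 as long as [x] is well inside the grid. Near its
    border they may add up to less, and the sum is bounded through the sign of the increments
    instead. *)
Lemma gridconv_le e (n m : nat) u x z (M : R) : 0 < e -> (0 < n)%N ->
  (forall p, (forall j, `|(x - p) ord0 j| < e) -> u (p + z) - u p <= M) ->
  ((forall j, `|x ord0 j| <= (m%:R - 1) * e) \/ 0 <= M /\
   (forall p, (forall j, `|(x - p) ord0 j| < e) -> u (p + z) - u p <= 0)) ->
  \sum_k ((u (gridpt (e / n%:R) (m * n) k + z) - u (gridpt (e / n%:R) (m * n) k))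
      / n%:R ^+ d) * bump e (x - gridpt (e / n%:R) (m * n) k) <= M.
Proof.
move=> e0 n0 HM Hx; have nd : 0 < n%:R ^+ d :> R by rewrite exprn_gt0// ltr0n.
have key M' : (forall p, (forall j, `|(x - p) ord0 j| < e) -> u (p + z) - u p <= M') ->
  \sum_k ((u (gridpt (e / n%:R) (m * n) k + z) - u (gridpt (e / n%:R) (m * n) k))
      / n%:R ^+ d) * bump e (x - gridpt (e / n%:R) (m * n) k) <=
  M' / n%:R ^+ d * \sum_k bump e (x - gridpt (e / n%:R) (m * n) k).
  move=> HM'; rewrite mulr_sumr; apply: ler_sum => k _.
  have [->|/(bump_neq0 _ _ e0) h] := eqVneq (bump e (x - gridpt (e / n%:R) (m * n) k)) 0.
    by rewrite !mulr0.
  by rewrite ler_wpM2r ?bump_ge0// ler_wpM2r ?invr_ge0 ?(ltW nd)// HM'.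
case: Hx => [hx|[M0 h0]]; last by rewrite (le_trans (key 0 h0))// !mul0r.
by rewrite (le_trans (key M HM))// sum_bump// divfK ?gt_eqF.
Qed.

(** Only grid vectors are available for testing [q]. Rounding the vector of length [t] along [q] to
    the grid moves it by at most [d h], a loss that is negligible once [h] is small against [t]. *)
Lemma lattice_direction q h t (M : R) : 0 < h -> 0 < t -> 0 <= M ->
  (forall w : 'I_d -> int, let z := \row_j (h * (w j)%:~R) in
     enorm z <= t + d%:R * h -> dotv q z <= M * enorm z) ->
  enorm q * (t - d%:R * h) <= M * (t + d%:R * h).
Proof.
move=> h0 t0 M0 H; have th : 0 <= t + d%:R * h.
  by rewrite addr_ge0// ?mulr_ge0// ltW.
have [->|qn] := eqVneq (enorm q) 0; first by rewrite mul0r mulr_ge0.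
have q0 : 0 < enorm q by rewrite lt_neqAle eq_sym qn enorm_ge0.
pose v := (t / enorm q) *: q; pose w j := Num.floor (v ord0 j / h).
pose z := \row_j (h * (w j)%:~R) : 'rV[R]_d.
have zv : enorm (z - v) <= d%:R * h.
  apply: ler_enorm_coord => j; rewrite !mxE -/(v ord0 j).
  have /andP[f1 f2] := Num.Theory.floor_itv (v ord0 j / h).
  rewrite -/(w j) in f1 f2.
  have E : v ord0 j = h * (v ord0 j / h) by rewrite mulrC divfK ?gt_eqF.
  move: f2; rewrite rmorphD /= => f2.
  have -> : t / enorm q * q ord0 j = v ord0 j by rewrite mxE.
  rewrite {1}E -mulrBr normrM (gtr0_norm h0) ler_piMr ?(ltW h0)//.
  by rewrite ler_norml; lra.
have vE : enorm v = t.
  by rewrite enormZ gtr0_norm ?divr_gt0// divfK.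
have zt : enorm z <= t + d%:R * h.
  rewrite -[z](subrK v) (le_trans (ler_enormD _ _))// vE addrC lerD2l//.
have := H w zt; rewrite -/z => qz.
have qv : dotv q v = t * enorm q.
  by rewrite dotvZr dotvvE expr2 mulrA divfK.
have qzv : - (enorm q * (d%:R * h)) <= dotv q (z - v).
  rewrite lerNl -dotvNr (le_trans (dotv_le _ _))// enormN.
  by rewrite ler_wpM2l ?enorm_ge0.
have E : dotv q z = dotv q v + dotv q (z - v) by rewrite -dotvDr addrC subrK.
rewrite mulrBr (mulrC _ t) -qv (le_trans _ (ler_wpM2l M0 zt))//.
by rewrite (le_trans _ qz)// E lerD2l.
Qed.

(* Grid sums commute exactly with translations by grid vectors, so the subsolution inequality
   passes to [phi] along grid vectors, and the grid is finer than the scale of the bump. *)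
Lemma smooth_subsolution (Psi : 'rV[R]_d -> 'rV[R]_d) u (lam B r : R) :
  0 <= lam -> C0field Psi -> 0 <= r ->
  (forall x, r < enorm x -> Psi x = 0) -> (forall x, r < enorm x -> u x = 0) ->
  (forall x, `|u x| <= B) ->
  (forall e, 0 < e -> exists2 rho, 0 < rho & forall y z, enorm z < rho ->
     u (y + z) - u y <= (lam + e) * enorm z - dotv (Psi y) z) ->
  forall eta, 0 < eta -> exists2 phi, elementary phi /\ compact_support phi &
    forall x, enorm (grad phi x + Psi x) <= lam + eta.
Proof.
move=> lam0 CPsi r0 sPsi su uB Hu eta eta0.
(* One [e] each for the inequality of [u], the oscillation of [Psi] and the Taylor error gives
   [lam + 3 e]. Rounding to the grid adds a fourth, and the final division by [1 - sg] uses up the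
   rest. *)
pose e := eta / 8; have e0 : 0 < e by rewrite divr_gt0.
have B0 : 0 <= B by exact: le_trans (uB 0).
have [rho1 rho10 Hrho1] := Hu e e0.
have [rho2 rho20 Hrho2] := C0field_unif_continuous _ CPsi _ e0.
have d1 : 0 < d%:R + 1 :> R by rewrite ltr_wpDl.
have rho21 : 0 < Num.min rho2 1 by rewrite lt_min rho20 ltr01.
pose ep := Num.min rho2 1 / (d%:R + 1); have ep0 : 0 < ep by rewrite divr_gt0.
have ep1 : ep <= 1.
  by rewrite ler_pdivrMr// mul1r ge_min orbC (le_trans (y := 1))// lerDr.
have dep : d%:R * ep < rho2.
  apply: (@lt_le_trans _ _ (Num.min rho2 1)); last by rewrite ge_min lexx.
  by rewrite mulrCA gtr_pMr// ltr_pdivrMr// mul1r ltrDl.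
have Cf : C0field (grad (bump ep : 'rV[R]_d -> R)).
  by apply: (@C0field_grad _ _ _ (d%:R * ep)); [exact: elementary_bump0|
    move=> x; exact: bump_out].
(* The grid sees the full partition of unity up to distance 2 beyond the supports of [u] and [Psi]:
   one unit for the bump width, one for the increment. *)
pose m := (Num.bound ((r + 2) / ep)).+1.
have hm : r + 2 <= (m%:R - 1) * ep.
  have -> : m%:R - 1 = (Num.bound ((r + 2) / ep))%:R :> R.
    by rewrite /m -addn1 natrD addrK.
  rewrite -ler_pdivrMr// ltW// archi_boundP// divr_ge0 ?(ltW ep0)//.
  by rewrite addr_ge0.
have hm' : r + 1 <= ep * m%:R by move: hm; rewrite mulrBl mul1r mulrC; lra.
pose C : R := (2 * m + 1)%:R ^+ d * (B + 1).
have C0 : 0 < C by rewrite mulr_gt0 ?exprn_gt0 ?ltr0n ?addn1// ltr_wpDl.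
have [rho3 rho30 Hrho3] := C0field_unif_continuous _ Cf _ (divr_gt0 e0 C0).
pose t0 := Num.min (Num.min rho1 rho3) 1.
have t00 : 0 < t0 by rewrite !lt_min rho10 rho30 ltr01.
pose t := t0 / 2; have tp : 0 < t by rewrite divr_gt0.
have le0 : 0 < lam + 3 * e by lra.
pose sg := e / (lam + 3 * e); have sg0 : 0 < sg by rewrite divr_gt0.
have sgE : sg * (lam + 3 * e) = e by rewrite divfK ?gt_eqF.
have sg1 : sg <= 1 / 3 by rewrite ler_pdivrMr//; lra.
(* The mesh is chosen last, fine enough that rounding a vector of length [t] costs only the fraction
   [sg]. This is possible because [C], hence [t], does not involve [n]. *)
pose n := (Num.bound (d%:R * ep / (sg * t))).+1.
have nR : 0 < n%:R :> R by rewrite ltr0n.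
pose h := ep / n%:R; have h0 : 0 < h by rewrite divr_gt0.
have st0 : 0 < sg * t by rewrite mulr_gt0.
have dh : d%:R * h <= sg * t.
  rewrite /h mulrA ler_pdivrMr// [leRHS]mulrC -ler_pdivrMr//.
  rewrite /n -addn1 natrD ler_wpDr// ltW// archi_boundP//.
  by apply: divr_ge0; [apply: mulr_ge0 => //; exact: ltW|exact: ltW].
pose phi := gridconv ep n m u.
exists phi.
  split; first exact: elementary_gridconv.
  exists (r + d%:R * ep) => x rx; apply: big1 => k _.
  have [/su ->|pr] := ltP r (enorm (gridpt (ep / n%:R) (m * n) k)).
    by rewrite !mul0r.
  rewrite bump_out ?mulr0//.
  have := ler_enormD (x - gridpt (ep / n%:R) (m * n) k) (gridpt (ep / n%:R) (m * n) k).
  by rewrite subrK; lra.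
move=> x; set q := grad phi x + Psi x.
have le3 : 0 <= lam + 3 * e by exact: ltW.
have := @lattice_direction q h t (lam + 3 * e) h0 tp le3.
have H : forall w : 'I_d -> int, let z := \row_j (h * (w j)%:~R) in
   enorm z <= t + d%:R * h -> dotv q z <= (lam + 3 * e) * enorm z.
  move=> w z zt.
  have zt0 : enorm z < t0.
    have : sg * t <= 1 / 3 * t by rewrite ler_pM2r.
    have tE : t0 = 2 * t by rewrite /t; field.
    lra.
  move: zt0; rewrite !lt_min => /andP[/andP[z1 z3] zz1].
  have T : dotv (grad phi x) z <= phi (x + z) - phi x + e * enorm z.
    have T0 : `|phi (x + z) - phi x - dotv (grad phi x) z| <=
        (2 * m + 1)%:R ^+ d * B * (e / C) * enorm z.
      apply: gridconv_taylor => // p1 p2 p12.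
      by apply/ltW/Hrho3; rewrite (le_lt_trans p12).
    have T1 : (2 * m + 1)%:R ^+ d * B * (e / C) * enorm z <= e * enorm z.
      rewrite ler_wpM2r ?enorm_ge0// mulrCA ger_pMr// ler_pdivrMr// mul1r.
      by rewrite ler_wpM2l ?exprn_ge0// lerDl.
    by move: T0; rewrite ler_norml => /andP[]; lra.
  have S : phi (x + z) - phi x <= (lam + 2 * e) * enorm z - dotv (Psi x) z.
    have zj j : `|z ord0 j| <= 1 by rewrite (le_trans (ler_coord_enorm _ _))// ltW.
    rewrite /phi (@gridconv_shift _ _ _ _ _ r)//; last 2 first.
    - by move=> y j yj; apply: su; rewrite (lt_le_trans yj)// ler_coord_enorm.
    - by move=> j; have := zj j; rewrite mxE normrM (gtr0_norm h0) -intr_norm.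
    apply: gridconv_le => // [p xp|].
      have xp2 : enorm (p - x) < rho2.
        rewrite (le_lt_trans _ dep)// enormB; apply: ler_enorm_coord => j.
        exact/ltW/xp.
      rewrite (le_trans (Hrho1 p z z1))//.
      have := dotv_le (- (Psi p - Psi x)) z; rewrite enormN => D.
      have : enorm (Psi p - Psi x) * enorm z <= e * enorm z.
        by rewrite ler_wpM2r ?enorm_ge0// ltW// Hrho2.
      by move: D; rewrite dotvNl dotvDl dotvNl; lra.
    (* Otherwise [x] is so far out that [Psi x = 0] and [u] vanishes at every [p] and [p + z]
       concerned, so the increments are zero. *)
    have [/forallP hx|/existsP[j]] := boolP [forall j, `|x ord0 j| <= (m%:R - 1) * ep].
      by left.
    rewrite -ltNge => xj; right; have rx : r < enorm x.
      by have := ler_coord_enorm x j; lra.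
    rewrite (sPsi _ rx) dotv0l subr0; split.
      by rewrite mulr_ge0 ?enorm_ge0//; lra.
    move=> p /(_ j) xp; have pj : r + 1 < `|p ord0 j|.
      have := ler_normD (x ord0 j - p ord0 j) (p ord0 j); rewrite subrK.
      by move: xp; rewrite !mxE; lra.
    rewrite !su ?subrr//.
      by have := ler_coord_enorm p j; lra.
    have := ler_coord_enorm (p + z) j; have := zj j; rewrite [(p + z) _ _]mxE => zj1.
    have := ler_normD (p ord0 j + z ord0 j) (- z ord0 j); rewrite addrK normrN; lra.
  by rewrite /q dotvDl; lra.
move=> /(_ H) Q.
have sgt : enorm q * (t * (1 - sg)) <= (lam + 3 * e) * (t * (1 + sg)).
  rewrite (le_trans _ (le_trans Q _))//.
    by rewrite ler_wpM2l ?enorm_ge0//; lra.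
  by rewrite ler_wpM2l//; lra.
have {}sgt : enorm q * (1 - sg) <= lam + 4 * e.
  have : (lam + 3 * e) * (1 + sg) = lam + 4 * e by rewrite mulrDr mulr1 mulrC; lra.
  by move=> <-; move: sgt; rewrite !(mulrCA _ t) ler_pM2l.
have E8 : eta = 8 * e by rewrite /e; field.
have sg2 : 0 < 1 - sg by lra.
rewrite -(ler_pM2r sg2) (le_trans sgt)// E8.
have : sg * e <= 1 / 3 * e by rewrite ler_pM2r.
rewrite mulrDr in sgE; lra.
Qed.

End Smoothing.

(** * Unit-speed arcs *)

Section Integral.
Context {R : realType}.
Implicit Types (f G : R -> R) (L : R).

(* Starting the integral at [-1] makes the primitive two-sidedly differentiable on [[0, L]]. *)
Lemma exists_primitive f : continuous f ->
  exists G, forall t : R, -1 < t -> is_derive t 1 G (f t).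
Proof.
move=> cf; exists (fun t => \int[lebesgue_measure]_(s in `[-1, t]) f s) => t t1.
have tt : t < t + 1 by rewrite ltrDl.
have If : lebesgue_measure.-integrable `[-1, t + 1] (EFin \o f).
  by apply: continuous_compact_integrable; [exact: segment_compact|exact: continuous_subspaceT].
have [] := @continuous_FTC1_closed R f (-1) t (t + 1) tt If t1 (cf t).
by move=> d1 d2; exact: (DeriveDef d1 (etrans (esym (derive1E _ _)) d2)).
Qed.

(** Through primitives, splitting, linearity and mean value bounds for these integrals become
    statements about differences [G L - G 0]. *)
Lemma Rintegral_primitive f G L : continuous f -> 0 <= L ->
  (forall t : R, -1 < t -> is_derive t 1 G (f t)) ->
  \int[lebesgue_measure]_(s in `[0, L]) f s = G L - G 0.
Proof.
move=> cf; rewrite le_eqVlt => /orP[/eqP <- _|L0 dG].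
  by rewrite set_itv1 Rintegral_set1 subrr.
have cG t : -1 < t -> {for t, continuous G}.
  by move=> /dG dGt; apply/differentiable_continuous/derivable1_diffP; case: dGt.
rewrite /Rintegral (@continuous_FTC2 R f G 0 L L0) //.
- exact: continuous_subspaceT.
- split.
  + by move=> t; rewrite in_itv/= => /andP[t0 _]; case: (dG t); first lra.
  + by apply: cvg_at_right_filter; apply: cG; lra.
  + by apply: cvg_at_left_filter; apply: cG; lra.
- move=> t; rewrite in_itv/= => /andP[t0 _]; rewrite derive1E.
  by apply: derive_val; apply: dG; lra.
Qed.

Lemma Rintegral_itv_split f L1 L2 : continuous f -> 0 <= L1 -> 0 <= L2 ->
  \int[lebesgue_measure]_(s in `[0, L1 + L2]) f s =
  \int[lebesgue_measure]_(s in `[0, L1]) f s +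
  \int[lebesgue_measure]_(s in `[0, L2]) f (s + L1).
Proof.
move=> cf L10 L20; have [G dG] := exists_primitive _ cf.
have cf1 : continuous (fun s => f (s + L1)).
  move=> t; apply: continuous_comp; last exact: cf.
  by apply: continuousD; [exact: cvg_id|exact: cvg_cst].
have dG1 : forall t : R, -1 < t -> is_derive t 1 (fun s => G (s + L1)) (f (t + L1)).
  move=> t t1; have tL : -1 < t + L1 by lra.
  have := @is_derive1_comp R G (shift L1) t _ _ (dG _ tL) (is_derive_shift t 1 L1).
  by rewrite mulr1.
rewrite (Rintegral_primitive _ _ _ cf (addr_ge0 L10 L20) dG).
rewrite (Rintegral_primitive _ _ _ cf L10 dG) (Rintegral_primitive _ _ _ cf1 L20 dG1).
by rewrite add0r (addrC L2); ring.
Qed.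

Lemma Rintegral_itv_MVT f L : continuous f -> 0 <= L ->
  exists2 c, c \in `[0, L] & \int[lebesgue_measure]_(s in `[0, L]) f s = f c * L.
Proof.
move=> cf L0; have [G dG] := exists_primitive _ cf.
have dG' t : t \in `]0, L[ -> is_derive t 1 G (f t).
  by rewrite in_itv/= => /andP[? _]; apply: dG; lra.
have cG : {within `[0, L], continuous G}.
  apply: derivable_within_continuous => t; rewrite in_itv/= => /andP[? _].
  by case: (dG t); first lra.
have [c cL E] := MVT_segment L0 dG' cG.
by exists c => //; rewrite (Rintegral_primitive _ _ _ cf L0 dG) E subr0.
Qed.

Lemma Rintegral_itv_ge f L (c : R) : continuous f -> 0 <= L ->
  (forall t, 0 <= t <= L -> c <= f t) ->
  c * L <= \int[lebesgue_measure]_(s in `[0, L]) f s.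
Proof.
move=> cf L0 H; have [t + ->] := Rintegral_itv_MVT _ _ cf L0.
by rewrite in_itv => /H ct; rewrite ler_wpM2r.
Qed.

Lemma Rintegral_itv_le f L (c : R) : continuous f -> 0 <= L ->
  (forall t, 0 <= t <= L -> f t <= c) ->
  \int[lebesgue_measure]_(s in `[0, L]) f s <= c * L.
Proof.
move=> cf L0 H; have [t + ->] := Rintegral_itv_MVT _ _ cf L0.
by rewrite in_itv => /H ct; rewrite ler_wpM2r.
Qed.

End Integral.

(** * Gluing differentiable curves *)

Section Glue.
Context {R : realType} {V : normedModType R}.
Implicit Types (f g : R -> V) (a t : R).

Definition glue a f g : R -> V := fun t => if t <= a then f t else g t.

(** Each difference quotient of the glued curve at [a] is one of [f] or one of [g]. As these are
    differentiable on both sides of [a], the derivative at the joint is two-sided. *)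
Lemma glue_is_derive a f g v : f a = g a -> is_derive a 1 f v -> is_derive a 1 g v ->
  is_derive a 1 (glue a f g) v.
Proof.
move=> fg [/cvg_ex[lf cf] ef] [/cvg_ex[lg cg] eg].
have {}ef : lf = v by rewrite -ef; apply/esym; exact: cvg_lim cf.
have {}eg : lg = v by rewrite -eg; apply/esym; exact: cvg_lim cg.
subst lf lg.
have H : h^-1 *: ((glue a f g \o shift a) (h *: 1) - glue a f g a) @[h --> 0^'] --> v.
  apply/cvgrPdist_le => e e0.
  have /cvgrPdist_le/(_ e e0) nf := cf; have /cvgrPdist_le/(_ e e0) ng := cg.
  near=> h; rewrite /glue /= lexx; case: ifPn => _.
    by near: h.
  by rewrite fg; near: h.
by split; [apply/cvg_ex; exists v|exact: cvg_lim H].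
Unshelve. all: by end_near. Qed.

Lemma glue_continuous a f g : f a = g a -> continuous f -> continuous g ->
  continuous (glue a f g).
Proof.
move=> fg cf cg t; apply/cvgrPdist_le => e e0.
have [ta|ta|ta] := ltgtP t a.
- have /cvgrPdist_le/(_ e e0) nf := cf t.
  near=> s; rewrite /glue (ltW ta) ifT; first by near: s.
  by apply/ltW; near: s; exact: lt_nbhsl.
- have /cvgrPdist_le/(_ e e0) ng := cg t.
  near=> s; rewrite /glue !ifF; first by near: s.
    by apply/negbTE; rewrite -ltNge; near: s; exact: lt_nbhsr.
  by apply/negbTE; rewrite -ltNge.
- have /cvgrPdist_le/(_ e e0) nf := cf t; have /cvgrPdist_le/(_ e e0) ng := cg t.
  near=> s; rewrite /glue ta lexx -ta; case: ifPn => _; first by near: s.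
  by rewrite ta fg -ta; near: s.
Unshelve. all: by end_near. Qed.

Lemma is_derive_lshift g a t v : is_derive (t - a) 1 g v ->
  is_derive t 1 (fun s => g (s - a)) v.
Proof.
move=> [dg eg].
have E : (fun h : R => h^-1 *: (((fun s => g (s - a)) \o shift t) (h *: 1) - g (t - a))) =
    (fun h : R => h^-1 *: ((g \o shift (t - a)) (h *: 1) - g (t - a))).
  by apply/funext => h /=; rewrite addrA.
split; first by move: dg; rewrite /derivable -E.
by rewrite -eg /derive; exact: (congr1 (fun k : R -> V => lim (k @ 0^')) E).
Qed.

Lemma glue_is_derive_all a f g (df dg : R -> V) : f a = g 0 -> df a = dg 0 ->
  (forall t, is_derive t 1 f (df t)) -> (forall t, is_derive t 1 g (dg t)) ->
  forall t, is_derive t 1 (glue a f (fun s => g (s - a)))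
    (glue a df (fun s => dg (s - a)) t).
Proof.
move=> fg dfg hf hg t.
have hg' (s : R) : is_derive s 1 (fun s => g (s - a)) (dg (s - a)) by exact: is_derive_lshift.
have [ta|ta|ta] := ltgtP t a.
- rewrite /(glue _ df) (ltW ta); apply: (near_eq_is_derive (f := f)) => //.
  near=> s; rewrite /glue ifT//; apply/ltW; near: s; exact: lt_nbhsl.
- rewrite /(glue _ df) ifF; last by apply/negbTE; rewrite -ltNge.
  apply: (near_eq_is_derive (f := fun s => g (s - a))) => //.
  near=> s; rewrite /glue ifF//; apply/negbTE; rewrite -ltNge; near: s; exact: lt_nbhsr.
- rewrite ta /(glue _ df) lexx; apply: glue_is_derive; first by rewrite subrr.
  by have := hg' a; rewrite subrr -dfg.
Unshelve. all: by end_near. Qed.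

End Glue.

(** * Arcs with prescribed positions and velocities at both ends *)

Section Arcs.
Context {R : realType} {d : nat}.
Implicit Types (x y z v w o p q : 'rV[R]_d) (g : R -> 'rV[R]_d) (L t : R)
  (Phi : 'rV[R]_d -> 'rV[R]_d).

Lemma continuous_dotv (T : topologicalType) (f g : T -> 'rV[R]_d) :
  continuous f -> continuous g -> continuous (fun r => dotv (f r) (g r)).
Proof.
move=> cf cg t; rewrite /dotv.
have cc (h : T -> 'rV[R]_d) (j : 'I_d) : continuous h ->
    {for t, continuous (fun s => h s ord0 j)}.
  move=> ch; have cj := differentiable_continuous (@differentiable_coord R 1 d (h t) ord0 j).
  exact: (@continuous_comp _ _ _ h (fun M : 'rV[R]_d => M ord0 j) t (ch t) cj).
elim: (index_enum _) => [|i s IH].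
  rewrite (_ : (fun r : T => _) = fun=> 0); first exact: cst_continuous.
  by apply/funext => r; rewrite big_nil.
rewrite (_ : (fun r : T => _) = fun r : T => f r ord0 i * g r ord0 i +
    \sum_(j <- s) f r ord0 j * g r ord0 j).
  exact: (continuousD (continuousM (cc _ _ cf) (cc _ _ cg)) IH).
by apply/funext => r; rewrite big_cons.
Qed.

(** Curves are defined on the whole line and cut to [[0, L]] afterwards, so that derivatives at the
    ends and at joints are ordinary two-sided ones. *)
Definition unit_speed g := [/\ forall t, derivable g t 1,
  continuous (derive1 g) & forall t, enorm (derive1 g t) = 1].

Lemma is_derive_row g (dg : 'rV[R]_d) t :
  (forall j, is_derive t 1 (fun s : R => g s ord0 j) (dg ord0 j)) -> is_derive t 1 g dg.
Proof.
move=> H; have D : derivable g t 1.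
  by apply/derivable_mxP => i j; rewrite (ord1 i); case: (H j).
apply: (DeriveDef D); rewrite derive_mx//; apply/rowP => j; rewrite mxE.
by case: (H j).
Qed.

Lemma unit_speedI g (dg : R -> 'rV[R]_d) : (forall t, is_derive t 1 g (dg t)) ->
  continuous dg -> (forall t, enorm (dg t) = 1) -> unit_speed g /\ derive1 g = dg.
Proof.
move=> H cdg n1; have E : derive1 g = dg.
  by apply/funext => t; rewrite derive1E; case: (H t).
by split => //; split; rewrite ?E// => t; case: (H t).
Qed.

Lemma unit_speed_continuous g : unit_speed g -> continuous g.
Proof.
by move=> [dg _ _] t; apply/differentiable_continuous/derivable1_diffP.
Qed.

Lemma unit_speed_is_derive g t : unit_speed g -> is_derive t 1 g (derive1 g t).
Proof. by move=> [dg _ _]; apply: DeriveDef; [exact: dg|rewrite derive1E]. Qed.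

(** The mean value theorem is applied to the scalar function [g . e], where [e] is the displacement
    itself; it gives [|e| ^ 2 <= |e| t]. *)
Lemma unit_speed_dist g t : unit_speed g -> 0 <= t -> enorm (g t - g 0) <= t.
Proof.
move=> ug t0; set e := g t - g 0.
have dg (s : R) : is_derive s 1 (fun r : R => dotv (g r) e) (dotv (derive1 g s) e).
  have [dgs] := unit_speed_is_derive _ s ug.
  move/matrixP => eg.
  have dj (j : 'I_d) : is_derive s 1 (fun r : R => g r ord0 j) (derive1 g s ord0 j).
    split; first by move/derivable_mxP : dgs; exact.
    by rewrite -eg derive_mx// mxE.
  rewrite /dotv; elim: (index_enum _) => [|i l IH].
    rewrite (_ : (fun r => _) = fun=> 0); last by apply/funext => r; rewrite big_nil.
    by rewrite big_nil; exact: is_derive_cst.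
  rewrite (_ : (fun r => _) = fun r => g r ord0 i * e ord0 i +
      \sum_(j <- l) g r ord0 j * e ord0 j).
    rewrite big_cons; apply: is_deriveD => //.
    have := is_deriveZ (e ord0 i) (dj i); rewrite mulrC; congr is_derive.
    by apply/funext => r; rewrite mulrC.
  by apply/funext => r; rewrite big_cons.
have cg : {within `[0, t], continuous (fun r : R => dotv (g r) e)}.
  apply: continuous_subspaceT; apply: continuous_dotv; first exact: unit_speed_continuous.
  exact: cst_continuous.
have [s _] := MVT_segment t0 (fun s _ => dg s) cg.
rewrite subr0 -dotvNl -dotvDl -/e dotvvE => E.
have [->|en] := eqVneq (enorm e) 0; first exact: t0.
have e0 : 0 < enorm e by rewrite lt_neqAle eq_sym en enorm_ge0.
rewrite -(ler_pM2l e0) -expr2 E ler_wpM2r//.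
by rewrite (le_trans (dotv_le _ _))//; case: ug => _ _ ->; rewrite mul1r.
Qed.

Lemma continuous_integrand g Phi : unit_speed g -> continuous Phi ->
  continuous (fun t => dotv (derive1 g t) (Phi (g t))).
Proof.
move=> ug cPhi; apply: continuous_dotv; first by case: ug.
move=> t; apply: continuous_comp; last exact: cPhi.
exact: unit_speed_continuous.
Qed.

Lemma curve_action_norm_le g L Phi (M : R) : unit_speed g -> continuous Phi -> 0 <= L ->
  (forall t, 0 <= t <= L -> enorm (Phi (g t)) <= M) -> `|curve_action g L Phi| <= M * L.
Proof.
move=> ug cPhi L0 H; have ci := continuous_integrand _ _ ug cPhi.
have B t : 0 <= t <= L -> `|dotv (derive1 g t) (Phi (g t))| <= M.
  move=> /H; apply: le_trans; rewrite (le_trans (ler_norm_dotv _ _))//.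
  by case: ug => _ _ ->; rewrite mul1r.
rewrite ler_norml -mulNr; apply/andP; split.
  by apply: Rintegral_itv_ge => // t /B; rewrite ler_norml => /andP[].
by apply: Rintegral_itv_le => // t /B; rewrite ler_norml => /andP[].
Qed.

Lemma curve_action_lin g L (I : finType) (c : I -> R)
    (Phi : I -> 'rV[R]_d -> 'rV[R]_d) : unit_speed g -> 0 <= L ->
  (forall i, continuous (Phi i)) ->
  curve_action g L (fun x => \sum_i c i *: Phi i x) =
  \sum_i c i * curve_action g L (Phi i).
Proof.
move=> ug L0 cPhi; pose f i t := dotv (derive1 g t) (Phi i (g t)).
have cf i : continuous (f i) by exact: continuous_integrand.
have /choice[G dG] i := exists_primitive _ (cf i).
have [cF dF] : continuous (fun t => \sum_i c i * f i t) /\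
    (forall t : R, -1 < t -> is_derive t 1 (fun t => \sum_i c i * G i t) (\sum_i c i * f i t)).
  elim: (index_enum I) => [|i s [IH1 IH2]].
    split.
      rewrite (_ : (fun t => _) = fun=> 0); first exact: cst_continuous.
      by apply/funext => r; rewrite big_nil.
    move=> t _; rewrite (_ : (fun t => _) = fun=> 0); last by apply/funext => r; rewrite big_nil.
    by rewrite big_nil; exact: is_derive_cst.
  split.
    rewrite (_ : (fun t => _) = fun t => c i * f i t + \sum_(j <- s) c j * f j t).
      move=> t.
      exact: (continuousD (continuousM (@cst_continuous _ _ (c i) t) (cf i t)) (IH1 t)).
    by apply/funext => r; rewrite big_cons.
  move=> t t1; rewrite (_ : (fun t => _) = fun t => c i * G i t + \sum_(j <- s) c j * G j t).
    rewrite big_cons; apply: is_deriveD; last exact: IH2.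
    exact: (is_deriveZ (c i) (dG i t t1)).
  by apply/funext => r; rewrite big_cons.
rewrite /curve_action.
under eq_Rintegral do rewrite dotv_sumr.
rewrite (Rintegral_primitive _ _ _ cF L0 dF) -sumrB; apply: eq_bigr => i _.
by rewrite (Rintegral_primitive _ _ _ (cf i) L0 (dG i)) mulrBr.
Qed.

(** Recording the velocities [v] and [w] along with the end points makes arcs composable without
    corners. *)
Definition arc g L x v y w := [/\ unit_speed g, 0 <= L, g 0 = x /\ derive1 g 0 = v
  & g L = y /\ derive1 g L = w].

Lemma arc_glue g1 g2 L1 L2 x v y w z o :
  arc g1 L1 x v y w -> arc g2 L2 y w z o ->
  exists2 g, arc g (L1 + L2) x v z o & forall Phi, continuous Phi ->
    curve_action g (L1 + L2) Phi = curve_action g1 L1 Phi + curve_action g2 L2 Phi.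
Proof.
move=> [u1 L10 [x1 v1] [y1 w1]] [u2 L20 [y2 w2] [z2 o2]].
pose g := glue L1 g1 (fun s => g2 (s - L1)).
pose dg := glue L1 (derive1 g1) (fun s => derive1 g2 (s - L1)).
have [ug Eg] : unit_speed g /\ derive1 g = dg.
  apply: unit_speedI.
  - apply: (@glue_is_derive_all _ _ L1 g1 g2 (derive1 g1) (derive1 g2)
      (etrans y1 (esym y2)) (etrans w1 (esym w2))) => t; exact: unit_speed_is_derive.
  - apply: glue_continuous; first by rewrite subrr w1 w2.
      by case: u1.
    move=> t; apply: continuous_comp; last by case: u2 => _ + _; apply.
    by apply: continuousB; [exact: cvg_id|exact: cst_continuous].
  - move=> t; rewrite /dg /glue; case: ifPn => _; first by case: u1.
    by case: u2.
(* At the joint, [t = 0], the glued curve takes the branch of the first arc; the two branches agree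
   there. *)
have gE (T : Type) (f h : R -> T) t : 0 <= t -> f L1 = h 0 ->
    (if t + L1 <= L1 then f (t + L1) else h (t + L1 - L1)) = h t.
  move=> t0 fh; rewrite addrK; case: ifPn => //; rewrite gerDr => t0'.
  by have -> : t = 0; [apply/eqP; rewrite eq_le t0 t0'|rewrite add0r].
have glueE t : 0 <= t -> g (t + L1) = g2 t by move=> t0; apply: gE; rewrite // y1.
have dglueE t : 0 <= t -> dg (t + L1) = derive1 g2 t.
  by move=> t0; apply: gE; rewrite // w1.
exists g.
  split => //; first exact: addr_ge0.
    by rewrite Eg /dg /g /glue L10.
  by rewrite addrC Eg glueE// dglueE.
move=> Phi cPhi; rewrite /curve_action Rintegral_itv_split//; last exact: continuous_integrand.
congr (_ + _); apply: eq_Rintegral => t; rewrite inE /= in_itv/= => /andP[t0 t1].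
  by rewrite Eg /dg /g /glue t1.
by rewrite Eg dglueE// glueE.
Qed.

Lemma line_unit_speed x v : enorm v = 1 ->
  unit_speed (fun t => x + t *: v) /\ derive1 (fun t : R => x + t *: v) = fun=> v.
Proof.
move=> v1; apply: unit_speedI => //; last exact: cst_continuous.
move=> t; apply: is_derive_row => j.
rewrite (_ : (fun s : R => _) = cst (x ord0 j) + v ord0 j \*: (id : R -> R)); last first.
  by apply/funext => s /=; rewrite !mxE mulrC.
apply: (is_derive_eq (is_deriveD (is_derive_cst (x ord0 j) t 1)
  (is_deriveZ (v ord0 j) (is_derive_id t 1)))).
by rewrite add0r /GRing.scale /= mulr1.
Qed.

Lemma arc_segment x v L : enorm v = 1 -> 0 <= L ->
  arc (fun t => x + t *: v) L x v (x + L *: v) v.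
Proof.
by move=> /(line_unit_speed x)[ug Eg] L0; split; rewrite ?Eg ?scale0r ?addr0.
Qed.

(** The circle of centre [c] and radius [r] in the plane of [p] and [q], run through by arclength up
    to the angle [al]. *)
Lemma arc_circle c p q (r al : R) : 0 < r -> 0 <= al -> enorm p = 1 -> enorm q = 1 ->
  dotv p q = 0 -> exists g, arc g (r * al) (c - r *: q) p
     (c + (r * sin al) *: p - (r * cos al) *: q) (cos al *: p + sin al *: q).
Proof.
move=> r0 al0 p1 q1 pq.
pose g t : 'rV[R]_d := c + (r * sin (t / r)) *: p - (r * cos (t / r)) *: q.
pose dg t : 'rV[R]_d := cos (t / r) *: p + sin (t / r) *: q.
have dr (t : R) : is_derive t 1 (fun s : R => s / r) r^-1.
  have := is_deriveZ r^-1 (is_derive_id t 1).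
  rewrite /GRing.scale /= mulr1; congr is_derive.
  by apply/funext => s /=; rewrite mulrC.
exists g.
have [ug Eg] : unit_speed g /\ derive1 g = dg.
  apply: unit_speedI.
  - move=> t; apply: is_derive_row => j.
    have ds := @is_derive1_comp R sin (fun s : R => s / r) t _ _ (is_derive_sin (t / r)) (dr t).
    have dc := @is_derive1_comp R cos (fun s : R => s / r) t _ _ (is_derive_cos (t / r)) (dr t).
    rewrite (_ : (fun s : R => _) = cst (c ord0 j) +
        (r * p ord0 j) \*: (sin \o (fun s : R => s / r)) +
        (- (r * q ord0 j)) \*: (cos \o (fun s : R => s / r))); last first.
      by apply/funext => s; rewrite /g !mxE !fctE /= /GRing.scale /=; ring.
    apply: (is_derive_eq (is_deriveD (is_deriveD (is_derive_cst (c ord0 j) t 1)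
      (is_deriveZ (r * p ord0 j) ds)) (is_deriveZ (- (r * q ord0 j)) dc))).
    rewrite !mxE /GRing.scale /= add0r; field; exact: lt0r_neq0.
  - move=> t; rewrite /dg.
    have cr : {for t, continuous (fun s : R => s / r)}.
      by apply/differentiable_continuous/derivable1_diffP; case: (dr t).
    have cc : {for t, continuous (fun s : R => cos (s / r))}.
      exact: (@continuous_comp _ _ _ (fun s : R => s / r) cos t cr (@continuous_cos R _)).
    have cs : {for t, continuous (fun s : R => sin (s / r))}.
      exact: (@continuous_comp _ _ _ (fun s : R => s / r) sin t cr (@continuous_sin R _)).
    have cp : {for t, continuous (fun s : R => cos (s / r) *: p)}.
      by apply: continuousZl; exact: cc.
    have cq : {for t, continuous (fun s : R => sin (s / r) *: q)}.
      by apply: continuousZl; exact: cs.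
    exact: (@continuousD R 'rV[R]_d _ (fun s : R => cos (s / r) *: p)
      (fun s : R => sin (s / r) *: q) t cp cq).
  - move=> t; apply/eqP; rewrite -(@eqrXn2 _ 2)// ?enorm_ge0// -dotvvE expr1n /dg.
    rewrite dotvDl !dotvDr !dotvZl !dotvZr (dotvC q p) pq !dotvvE p1 q1 !expr1n.
    by rewrite !mulr0 !mulr1 addr0 add0r -!expr2 cos2Dsin2.
split => //; first by rewrite mulr_ge0// ltW.
  by rewrite Eg /g /dg mul0r sin0 cos0 mulr0 mulr1 !scale0r !addr0 scale1r.
by rewrite Eg /g /dg (mulrC r al) mulfK ?gt_eqF.
Qed.

End Arcs.

(** * Changing the velocity at a point by a short detour *)

Section Reorient.
Context {R : realType} {d : nat}.
Implicit Types (x y z v w e : 'rV[R]_d) (g : R -> 'rV[R]_d) (L t : R)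
  (Phi : 'rV[R]_d -> 'rV[R]_d).

Lemma exists_orthogonal v : (2 <= d)%N -> exists2 e, enorm e = 1 & dotv v e = 0.
Proof.
move=> hd; pose i0 := Ordinal (ltnW hd); pose i1 := Ordinal hd.
have n01 : i0 != i1 by [].
have [v0|v0] := eqVneq (v ord0 i0) 0.
  by exists (evec i0); [exact: enorm_evec|rewrite dotv_evec].
pose f : 'rV[R]_d := v ord0 i1 *: evec i0 - v ord0 i0 *: evec i1.
have vf : dotv v f = 0.
  by rewrite dotvDr dotvNr !dotvZr !dotv_evec mulrC subrr.
have f1 : f ord0 i1 = - v ord0 i0.
  by rewrite !mxE eqxx [i1 == i0]eq_sym (negbTE n01) mulr0 mulr1 add0r.
have fn : enorm f != 0.
  by apply/eqP => /enorm_eq0 f0; move: f1 v0; rewrite f0 mxE => /eqP; rewrite eq_sym oppr_eq0 => ->.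
exists ((enorm f)^-1 *: f); last by rewrite dotvZr vf mulr0.
by rewrite enormZ ger0_norm ?invr_ge0 ?enorm_ge0// mulVf.
Qed.

(* Leave along [v], follow a large circular arc tangent to both lines, and come
   back along [w]. *)
Lemma arc_reorient_transverse x v w (del : R) : enorm v = 1 -> enorm w = 1 ->
  w != v -> w != - v -> 0 < del -> exists g L, 0 < L <= del /\ arc g L x v x w.
Proof.
move=> v1 w1 wv wNv del0; set C := dotv v w.
pose f := w - C *: v.
have vf : dotv v f = 0.
  by rewrite dotvDr dotvNr dotvZr dotvvE v1 expr1n mulr1 subrr.
have ffE : enorm f ^+ 2 = 1 - C ^+ 2.
  rewrite -dotvvE {1}/f dotvDl dotvNl dotvZl vf mulr0 subr0 dotvDr dotvNr dotvZr.
  by rewrite (dotvC w v) -/C dotvvE w1; ring.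
have fn : enorm f != 0.
  apply/eqP => f0; have wE : w = C *: v by apply/eqP; rewrite -subr_eq0 -/f (enorm_eq0 _ f0).
  move: ffE; rewrite f0 expr0n /= => /esym/eqP; rewrite subr_eq0 eq_sym sqrf_eq1.
  move=> /orP[] /eqP E; move: wE; rewrite E ?scale1r ?scaleN1r => /eqP.
    by rewrite (negbTE wv).
  by rewrite (negbTE wNv).
have f0 : 0 < enorm f by rewrite lt_neqAle eq_sym fn enorm_ge0.
have CC : C ^+ 2 < 1 by rewrite -subr_gt0 -ffE exprn_gt0.
have C1 : -1 < C < 1.
  by rewrite -ltr_norml -(@ltr_pXn2r _ 2)// ?nnegrE// expr1n -normrX ger0_norm ?sqr_ge0.
have /andP[Cm Cp] := C1.
(* With this sign [e] points away from [w], and the circle turns from [v] to [w] the long way round,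
   through the angle [2 pi - acos C]. Such a turn can end behind [x] on the line directed by [w]. *)
pose S := - enorm f; pose e := S^-1 *: f.
have Sn : S != 0 by rewrite oppr_eq0.
have e1 : enorm e = 1.
  by rewrite enormZ normrV ?unitfE// /S normrN ger0_norm ?enorm_ge0// mulVf.
have ve : dotv v e = 0 by rewrite dotvZr vf mulr0.
have wE : w = C *: v + S *: e by rewrite scalerA divff// scale1r addrC subrK.
have SC : S ^+ 2 = 1 - C ^+ 2 by rewrite sqrrN.
pose al := pi *+ 2 - acos C.
have [ac0 acE] : 0 <= acos C <= pi /\ cos (acos C) = C.
  by apply: acos_def; rewrite !ltW.
have calE : cos al = C by rewrite /al cosB cos2pi sin2pi mul1r mul0r addr0 acE.
have salE : sin al = S.
  rewrite /al sinB sin2pi cos2pi mul0r mul1r sub0r sin_acos ?ltW//.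
  by rewrite -ffE sqrtr_sqr ger0_norm ?enorm_ge0.
have al0 : 0 <= al by move: ac0; rewrite /al mulr2n; have := pi_ge0 R; lra.
have alpi : al <= pi *+ 2 by rewrite /al lerBlDr lerDl; case/andP: ac0.
have C1' : 0 < 1 - C by rewrite subr_gt0.
(* [K] is the length of the circular arc in units of [a]; with [a = del / (2 + K)] the two segments
   and the arc have total length exactly [del]. *)
pose K := - S / (1 - C) * al.
have K0 : 0 <= K by rewrite mulr_ge0// divr_ge0 ?opprK ?enorm_ge0// ltW.
pose a := del / (2 + K).
have a0 : 0 < a by rewrite divr_gt0// ltr_wpDr.
(* The radius for which the circle tangent to [v] at [x + a v] is also tangent to [w] at
   [x - a w]. *)
pose r := - (a * S) / (1 - C).
have rE : r * (1 - C) = - (a * S) by rewrite divfK// gt_eqF.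
have r0 : 0 < r by rewrite divr_gt0// -mulrN mulr_gt0// opprK.
have rS : a + r * S = - (a * C).
  have h : r * S * (1 - C) = - (a * (1 + C)) * (1 - C).
    by rewrite mulrAC rE mulNr -mulrA -expr2 SC; ring.
  have -> : r * S = - (a * (1 + C)) by move/(mulIf (lt0r_neq0 C1')) : h.
  by ring.
have A1 := arc_segment x v a v1 (ltW a0).
have [g2 A2] := arc_circle (x + a *: v + r *: e) v e r al r0 al0 v1 e1 ve.
have A3 := arc_segment (x - a *: w) w a w1 (ltW a0).
rewrite addrK calE salE -wE in A2.
rewrite subrK in A3.
have E : x + a *: v + r *: e + (r * S) *: v - (r * C) *: e = x - a *: w.
  have -> : x + a *: v + r *: e + (r * S) *: v - (r * C) *: e =
      x + (a + r * S) *: v + (r * (1 - C)) *: e.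
    by apply/rowP => j; rewrite !mxE; ring.
  by rewrite rS rE wE; apply/rowP => j; rewrite !mxE; ring.
rewrite E in A2.
have [g12 A12 _] := arc_glue _ _ _ _ _ _ _ _ _ _ A1 A2.
have [g A _] := arc_glue _ _ _ _ _ _ _ _ _ _ A12 A3.
exists g, (a + r * al + a); split=> //.
have ral : r * al = a * K by rewrite /r /K; ring.
rewrite ral; have aK : a * (2 + K) = del by rewrite divfK// gt_eqF// ltr_wpDr.
have aK0 : 0 <= a * K by rewrite mulr_ge0// ltW.
by rewrite mulrDr in aK; apply/andP; split; lra.
Qed.

(** For [w = v] or [w = - v] the two lines coincide and no circle joins them as in the transverse
    case; turning first to an orthogonal direction reduces to that case twice. *)
Lemma arc_reorient x v w (del : R) : (2 <= d)%N -> enorm v = 1 -> enorm w = 1 ->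
  0 < del -> exists g L, 0 < L <= del /\ arc g L x v x w.
Proof.
move=> hd v1 w1 del0.
have [/andP[wv wNv]|] := boolP ((w != v) && (w != - v)); first exact: arc_reorient_transverse.
rewrite negb_and !negbK => wvv.
have [e e1 ve] := exists_orthogonal v hd.
have ee : dotv e e = 1 by rewrite dotvvE e1 expr1n.
have vv : dotv v v = 1 by rewrite dotvvE v1 expr1n.
have e_neq (u : 'rV[R]_d) : u = v \/ u = - v -> e != u.
  move=> H; apply/eqP => eu; move: ve; rewrite eu.
  by case: H => ->; rewrite ?dotvNr vv => /eqP; rewrite ?oppr_eq0 oner_eq0.
have wv' : w = v \/ w = - v by case/orP: wvv => /eqP; [left|right].
have [g1 [L1 [/andP[L10 L1d] A1]]] : exists g L, 0 < L <= del / 2 /\ arc g L x v x e.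
  by apply: arc_reorient_transverse; rewrite ?divr_gt0// e_neq; auto.
have [g2 [L2 [/andP[L20 L2d] A2]]] : exists g L, 0 < L <= del / 2 /\ arc g L x e x w.
  apply: arc_reorient_transverse; rewrite ?divr_gt0// 1?eq_sym.
    by rewrite e_neq.
  rewrite eqr_oppLR e_neq//; case: wv' => ->; rewrite ?opprK; auto.
have [g A _] := arc_glue _ _ _ _ _ _ _ _ _ _ A1 A2.
exists g, (L1 + L2); split=> //; apply/andP; split; first exact: addr_gt0.
by rewrite (le_trans (lerD L1d L2d))// -splitr.
Qed.

End Reorient.

(** * The weak KAM subsolution *)

Section WeakKAM.
Context {R : realType} {d : nat}.
Implicit Types (x y z v w : 'rV[R]_d) (g : R -> 'rV[R]_d) (L t : R).
Hypothesis hd : (2 <= d)%N.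
Variables (Psi : 'rV[R]_d -> 'rV[R]_d) (r lam M : R).
Hypothesis CPsi : C0field Psi.
Hypothesis r0 : 0 <= r.
Hypothesis Psi_out : forall x, r < enorm x -> Psi x = 0.
Hypothesis lam0 : 0 < lam.
Hypothesis M0 : 0 <= M.
Hypothesis PsiM : forall x, enorm (Psi x) <= M.

Let cPsi : continuous Psi. Proof. by case: CPsi. Qed.

Lemma arc_end g L x v y w : arc g L x v y w -> enorm w = 1.
Proof. by move=> [[_ _ u1] _ _ [_ <-]]. Qed.

Lemma arc_action_ge g L x v y w : arc g L x v y w -> - (M * L) <= curve_action g L Psi.
Proof.
move=> [ug L0 _ _]; have := @curve_action_norm_le _ _ g L Psi M ug cPsi L0 (fun t _ => PsiM _).
by rewrite ler_norml => /andP[].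
Qed.

Lemma segment_action_ge x v L (a : R) : enorm v = 1 -> 0 <= L ->
  (forall t, 0 <= t <= L -> a <= dotv v (Psi (x + t *: v))) ->
  a * L <= curve_action (fun t => x + t *: v) L Psi.
Proof.
move=> v1 L0 H; have [ug _ _ _] := arc_segment x v L v1 L0.
apply: Rintegral_itv_ge => //; first exact: continuous_integrand.
move=> t tL; by have [_ ->] := line_unit_speed x v v1; exact: H.
Qed.

(** Turn at [y] into the direction of [z], then go straight. A turn of length [L2] costs at most
    [(lam + M) L2], which is made smaller than [del]; along the segment [a] bounds the gain per unit
    length from below. *)
Lemma arc_extend g L x v y w z (a del : R) : arc g L x v y w -> 0 < del ->
  (forall t, 0 <= t <= 1 -> a * enorm z <= dotv z (Psi (y + t *: z))) ->
  exists g' L' w', arc g' L' x v (y + z) w' /\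
    lam * L' - curve_action g' L' Psi <=
      lam * L - curve_action g L Psi + (lam - a) * enorm z + del.
Proof.
move=> A del0 H; have [z0|zn] := eqVneq (enorm z) 0.
  exists g, L, w; rewrite (enorm_eq0 _ z0) addr0; split=> //.
  by rewrite enorm0 mulr0 addr0 lerDl ltW.
have z0 : 0 < enorm z by rewrite lt_neqAle eq_sym zn enorm_ge0.
pose n := (enorm z)^-1 *: z.
have n1 : enorm n = 1 by rewrite enormZ gtr0_norm ?invr_gt0// mulVf.
have zE : enorm z *: n = z by rewrite scalerA divff// scale1r.
have lM : 0 < lam + M by rewrite ltr_wpDr.
have [g2 [L2 [/andP[L20 L2d] A2]]] :=
  arc_reorient y w n (del / (lam + M)) hd (arc_end _ _ _ _ _ _ A) n1 (divr_gt0 del0 lM).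
have A3 := arc_segment y n (enorm z) n1 (ltW z0); rewrite zE in A3.
have [g12 A12 E12] := arc_glue _ _ _ _ _ _ _ _ _ _ A A2.
have [g' A' E'] := arc_glue _ _ _ _ _ _ _ _ _ _ A12 A3.
exists g', (L + L2 + enorm z), n; split=> //.
rewrite E'// E12//.
have h2 := arc_action_ge _ _ _ _ _ _ A2.
have h3 : a * enorm z <= curve_action (fun t => y + t *: n) (enorm z) Psi.
  apply: segment_action_ge => //; first exact: ltW.
  move=> t /andP[t0 tz]; have := H (t / enorm z).
  rewrite divr_ge0 ?(ltW z0)//= ler_pdivrMr// mul1r => /(_ tz).
  have Ez p : dotv z p = enorm z * dotv n p by rewrite -{1}zE dotvZl.
  by rewrite -scalerA -/n Ez mulrC ler_pM2l.
have : (lam + M) * L2 <= del by rewrite mulrC -ler_pdivlMr.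
lra.
Qed.

Let v0 : 'rV[R]_d := evec (Ordinal hd).

Let arc0 : arc (fun t => 0 + t *: v0) 0 0 v0 0 v0.
Proof.
by have := arc_segment 0 v0 0 (enorm_evec _) (lexx _); rewrite scale0r addr0.
Qed.

Let act0 g : curve_action g 0 Psi = 0.
Proof. by rewrite /curve_action set_itv1 Rintegral_set1. Qed.

(** Actions of arcs from 0 to [y] for the Lagrangian [lam |v| - Psi . v]. The initial velocity is
    fixed so that an arc can be closed up to a loop; the final one is free, since turning costs
    arbitrarily little. *)
Definition costs y : set R := [set c | exists g L w, arc g L 0 v0 y w /\
  c = lam * L - curve_action g L Psi].

Definition mane_potential y : R := inf (costs y).

Hypothesis no_good_loop : forall g L x v, arc g L x v x v -> 0 < L ->
  curve_action g L Psi <= lam * L.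

Let extend_bound x z t : - M * enorm z <= dotv z (Psi (x + t *: z)).
Proof.
have := ler_norm_dotv z (Psi (x + t *: z)); rewrite ler_norml => /andP[h _].
by rewrite (le_trans _ h)// mulNr lerN2 mulrC ler_wpM2r ?enorm_ge0.
Qed.

Lemma costs_neq0 y : costs y !=set0.
Proof.
have [g [L [w [A _]]]] := arc_extend _ _ _ _ _ _ y (- M) 1 arc0 ltr01
  (fun t _ => extend_bound _ _ _).
by rewrite add0r in A; exists (lam * L - curve_action g L Psi); exists g, L, w.
Qed.

(** The way back along [- y] costs at most [(lam + M) |y|], the turns at most [del], and the
    resulting loop has nonnegative cost by [no_good_loop]. The last turn, back to [v0], also makes
    its length positive. *)
Lemma costs_ge y c : costs y c -> - ((lam + M) * enorm y) <= c.
Proof.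
move=> [g [L [w [A ->]]]]; apply/ler_addgt0Pr => del del0.
have d2 : 0 < del / 2 by rewrite divr_gt0.
have [g1 [L1 [w1 [A1 H1]]]] := arc_extend _ _ _ _ _ _ (- y) (- M) _ A d2
  (fun t _ => extend_bound _ _ _).
rewrite subrr in A1; rewrite enormN opprK in H1.
have lM : 0 < lam + M by rewrite ltr_wpDr.
have [g2 [L2 [/andP[L20 L2d] A2]]] := arc_reorient 0 w1 v0 (del / 2 / (lam + M)) hd
  (arc_end _ _ _ _ _ _ A1) (enorm_evec _) (divr_gt0 d2 lM).
have [g3 A3 E3] := arc_glue _ _ _ _ _ _ _ _ _ _ A1 A2.
have L10 : 0 <= L1 by case: A1.
have := no_good_loop _ _ _ _ A3 (ltr_wpDl L10 L20); rewrite E3//.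
have h2 := arc_action_ge _ _ _ _ _ _ A2.
have : (lam + M) * L2 <= del / 2 by rewrite mulrC -ler_pdivlMr.
rewrite !mulrDr !mulrDl => h3 h4.
have : del / 2 + del / 2 = del by rewrite -splitr.
rewrite mulrDl in H1; lra.
Qed.

Lemma costs_has_inf y : has_inf (costs y).
Proof.
split; first exact: costs_neq0.
by exists (- ((lam + M) * enorm y)) => c /costs_ge.
Qed.

(** Every arc reaching [y] extends to [y + z] at the cost given by [arc_extend]; the arbitrary [del]
    disappears in the infimum. *)
Lemma mane_potential_sub y z (a : R) :
  (forall t, 0 <= t <= 1 -> a * enorm z <= dotv z (Psi (y + t *: z))) ->
  mane_potential (y + z) <= mane_potential y + (lam - a) * enorm z.
Proof.
move=> H; rewrite -lerBlDr; apply: lb_le_inf; first exact: costs_neq0.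
move=> _ [g [L [w [A ->]]]]; rewrite lerBlDr; apply/ler_addgt0Pr => del del0.
have [g' [L' [w' [A' H']]]] := arc_extend _ _ _ _ _ _ z a _ A del0 H.
apply: le_trans H'; apply: ge_inf; first by case: (costs_has_inf (y + z)).
by exists g', L', w'.
Qed.

Lemma mane_potential_bound y : `|mane_potential y| <= (lam + M) * enorm y.
Proof.
rewrite ler_norml; apply/andP; split.
  by apply: lb_le_inf; [exact: costs_neq0|move=> c /costs_ge].
have h0 : mane_potential 0 <= 0.
  apply: ge_inf; first by case: (costs_has_inf 0).
  by exists (fun t => 0 + t *: v0), 0, v0; rewrite act0 mulr0 subrr.
have := @mane_potential_sub 0 y (- M) (fun t _ => extend_bound _ _ _).
by rewrite add0r opprK; lra.
Qed.

(* Truncating the potential to [[- kap, kap]] gives it compact support; [R'] is large enough for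
   the truncation to be inactive on the ball of radius [r + 1], outside of which [Psi = 0] and
   every [lam]-Lipschitz truncation is admissible. *)
Let R' : R := r + 1 + (lam + M) * (r + 1) / lam.
Let kap y : R := lam * Num.max 0 (R' - enorm y).
Let u y : R := Num.max (- kap y) (Num.min (mane_potential y) (kap y)).

Let R'_ge : r + 1 <= R'.
Proof.
rewrite lerDl divr_ge0 ?(ltW lam0)// mulr_ge0//; first by rewrite addr_ge0// ltW.
by rewrite addr_ge0.
Qed.

Let kap_ge0 y : 0 <= kap y.
Proof. by rewrite mulr_ge0 ?(ltW lam0)// le_max lexx. Qed.

Let kap_lip y z : kap (y + z) <= kap y + lam * enorm z /\
  - kap (y + z) <= - kap y + lam * enorm z.
Proof.
have h1 := ler_enormD y z; have h2 := ler_enormD (y + z) (- z).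
rewrite addrK enormN in h2; have z0 := enorm_ge0 z.
rewrite /kap; split; rewrite -?mulrN -mulrDr ler_pM2l//.
  by rewrite ge_max; apply/andP; split; rewrite -lerBlDr le_max; apply/orP;
    [left; lra|right; lra].
have h3 : 0 <= Num.max 0 (R' - enorm (y + z)) by rewrite le_max lexx.
have h4 : R' - enorm y <= Num.max 0 (R' - enorm (y + z)) + enorm z.
  by rewrite -lerBlDr le_max; apply/orP; right; lra.
suff : Num.max 0 (R' - enorm y) <= Num.max 0 (R' - enorm (y + z)) + enorm z by lra.
by rewrite ge_max h4 addr_ge0.
Qed.

Let u_inner y : enorm y <= r + 1 -> u y = mane_potential y.
Proof.
move=> yr; have H : `|mane_potential y| <= kap y.
  apply: (le_trans (mane_potential_bound y)).
  have lM : 0 <= lam + M by rewrite addr_ge0// ltW.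
  apply: (@le_trans _ _ ((lam + M) * (r + 1))); first by rewrite ler_wpM2l.
  rewrite /kap mulrC -ler_pdivrMl// mulrC le_max; apply/orP; right.
  by rewrite /R' (mulrC (lam + M)); lra.
move: H; rewrite ler_norml => /andP[h1 h2].
by rewrite /u min_l// max_r.
Qed.

Lemma weak_kam : exists u : 'rV[R]_d -> R, exists B r' : R,
  [/\ r <= r', forall x, r' < enorm x -> u x = 0, forall x, `|u x| <= B &
   forall e, 0 < e -> exists2 rho, 0 < rho & forall y z, enorm z < rho ->
     u (y + z) - u y <= (lam + e) * enorm z - dotv (Psi y) z].
Proof.
exists u, (lam * R'), R'; split.
- by apply: le_trans R'_ge; rewrite lerDl.
- move=> x xR; have k0 : kap x = 0.
    by rewrite /kap max_l ?mulr0// subr_le0 ltW.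
  rewrite /u k0 oppr0; apply/eqP; rewrite eq_le le_max lexx andbT.
  by rewrite ge_max lexx ge_min lexx orbT.
- move=> x; apply: (@le_trans _ _ (kap x)).
    rewrite /u ler_norml le_max lexx/= ge_max ge_min lexx orbT andbT.
    by rewrite (ge0_cp (kap_ge0 x)).
  rewrite /kap ler_pM2l// ge_max gerBl enorm_ge0 andbT.
  by rewrite (le_trans _ R'_ge)// addr_ge0.
move=> e e0; have [rho rho0 Hrho] := C0field_unif_continuous _ CPsi _ e0.
exists (Num.min rho (1 / 2)); first by rewrite lt_min rho0 divr_gt0.
move=> y z; rewrite lt_min => /andP[zrho z2].
have z0 := enorm_ge0 z.
(* As [|z| < 1 / 2], either [y] and [y + z] both lie in the ball of radius [r + 1], where the
   truncation is inactive, or the whole segment between them avoids the ball outside of which [Psi]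
   vanishes. *)
have [yr|yr] := leP (enorm y) (r + 1 / 2).
  rewrite !u_inner; [|by lra|by have := ler_enormD y z; lra].
  (* Chosen so that [a |z| = Psi y . z - e |z|], which by uniform continuity is a lower bound for
     [z . Psi] along the segment. *)
  pose a := if enorm z == 0 then 0 else dotv (Psi y) z / enorm z - e.
  have aE : a * enorm z = dotv (Psi y) z - e * enorm z.
    rewrite /a; case: eqVneq => [E|zn].
      by rewrite (enorm_eq0 _ E) dotv0r enorm0 !mulr0 subrr.
    by rewrite mulrBl divfK.
  have := @mane_potential_sub y z a; rewrite mulrBl aE => H.
  suff : mane_potential (y + z) <=
     mane_potential y + (lam * enorm z - (dotv (Psi y) z - e * enorm z)) by lra.
  apply: H => t /andP[t0 t1].
  have : enorm (Psi (y + t *: z) - Psi y) <= e.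
    apply/ltW/Hrho; rewrite addrC addKr enormZ ger0_norm// (le_lt_trans _ zrho)//.
    by rewrite ler_piMl.
  move=> h; have := dotv_le (- z) (Psi (y + t *: z) - Psi y).
  rewrite enormN dotvNl dotvDr dotvNr (dotvC z (Psi y)) => h'.
  have : enorm z * enorm (Psi (y + t *: z) - Psi y) <= enorm z * e by rewrite ler_wpM2l.
  by rewrite (mulrC (enorm z) e); lra.
have out t : 0 <= t <= 1 -> r < enorm (y + t *: z).
  move=> /andP[t0 t1]; have := ler_enormD (y + t *: z) (- (t *: z)).
  rewrite addrK enormN enormZ ger0_norm//.
  have : t * enorm z <= enorm z by rewrite ler_piMl.
  lra.
have Py : Psi y = 0 by apply: Psi_out; lra.
have Hu : mane_potential (y + z) <= mane_potential y + lam * enorm z.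
  have := @mane_potential_sub y z 0; rewrite subr0 mul0r; apply.
  by move=> t /out /Psi_out ->; rewrite dotv0r.
have [k1 k2] := kap_lip y z.
rewrite Py dotv0l subr0 lerBlDl.
apply: (@le_trans _ _ (u y + lam * enorm z)); last first.
  by rewrite lerD2l ler_wpM2r// lerDl ltW.
rewrite /u ge_max; apply/andP; split.
  by rewrite (le_trans k2)// lerD2r le_max lexx.
rewrite -lerBlDr le_max; apply/orP; right.
rewrite le_min; apply/andP; split; rewrite lerBlDr ge_min; apply/orP; [left|right] => //.
Qed.

End WeakKAM.

(** * Averages of closed curves *)

(* Blackwell's approachability argument: with [c] opposite to the accumulated error [S],
   each step adds at most a constant to [|S|^2], so [|S_N| = O(sqrt N)]. *)
Lemma greedy_average {R : realType} (I : finType) (T : Type) (kap : T -> I -> R)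
    (D : T -> Prop) (B : R) :
  (forall c : I -> R, exists2 t, D t & -1 <= \sum_i c i * kap t i) ->
  (forall t i, D t -> `|kap t i| <= B) ->
  forall e, 0 < e -> exists (N : nat) (f : nat -> T), [/\ (0 < N)%N, forall j, D (f j) &
    forall i, `|\sum_(j < N) kap (f j) i| <= N%:R * e].
Proof.
move=> step kapB e e0.
have /choice[pick Hpick] (c : I -> R) : exists t, D t /\ -1 <= \sum_i c i * kap t i.
  by have [t ? ?] := step c; exists t.
pose S := fix S n : I -> R := if n is n'.+1 then
  fun i => S n' i + kap (pick (fun i => - S n' i)) i else fun=> 0.
pose f n := pick (fun i => - S n i).
have SE n i : S n i = \sum_(j < n) kap (f j) i.
  by elim: n => [|n IH]; rewrite ?big_ord0// big_ord_recr /= -IH.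
(* Bound for one step: the squared increment contributes at most [#|I| B ^ 2], and the cross term at
   most 2 because the selected pairing is at least -1. *)
pose C := #|I|%:R * B ^+ 2 + 2.
have C0 : 0 < C by rewrite ltr_wpDl// mulr_ge0// sqr_ge0.
have E n : \sum_i S n i ^+ 2 <= n%:R * C.
  elim: n => [|n IH]; first by rewrite mul0r big1// => i _; rewrite expr0n.
  have [Df Hf] := Hpick (fun i => - S n i); rewrite -/(f n) in Df Hf.
  have -> : \sum_i S n.+1 i ^+ 2 = \sum_i S n i ^+ 2 -
      2 * (\sum_i - S n i * kap (f n) i) + \sum_i kap (f n) i ^+ 2.
    rewrite mulr_sumr -sumrB -big_split /=; apply: eq_bigr => i _.
    by rewrite -/(f n); ring.
  have : \sum_i kap (f n) i ^+ 2 <= #|I|%:R * B ^+ 2.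
    rewrite mulr_natl -sumr_const; apply: ler_sum => i _.
    rewrite -[kap _ _ ^+ 2]ger0_norm ?sqr_ge0// normrX lerXn2r ?nnegrE//; last exact: kapB.
    exact: le_trans (kapB _ i Df).
  have nE : n.+1%:R = n%:R + 1 :> R by rewrite natr1.
  have CE : C = #|I|%:R * B ^+ 2 + 2 by [].
  by rewrite nE mulrDl mul1r; lra.
(* [N e ^ 2 >= C] turns the bound [N C] on the squared error into [(N e) ^ 2]. *)
pose N := (Num.bound (C / e ^+ 2)).+1.
have e2 : 0 < e ^+ 2 by rewrite exprn_gt0.
exists N, f; split=> //; first by move=> j; case: (Hpick (fun i => - S j i)).
move=> i; rewrite -SE -(@ler_pXn2r _ 2)// ?nnegrE ?mulr_ge0 ?(ltW e0)//.
rewrite -normrX ger0_norm ?sqr_ge0//.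
apply: (@le_trans _ _ (\sum_i S N i ^+ 2)).
  by rewrite (bigD1 i)//= lerDl sumr_ge0// => j _; exact: sqr_ge0.
rewrite (le_trans (E N))// exprMn [N%:R ^+ 2]expr2 -mulrA ler_wpM2l//.
rewrite -ler_pdivrMr// ltW// (lt_le_trans (archi_boundP _))// ?ler_nat//.
by rewrite divr_ge0 ?ltW.
Qed.

(** * Closed curves of large mean action and their averages *)

Section Loops.
Context {R : realType} {d : nat}.
Implicit Types (x y z v w : 'rV[R]_d) (g : R -> 'rV[R]_d) (L : R)
  (Phi Psi : 'rV[R]_d -> 'rV[R]_d).

Definition loop g L := exists x v, arc g L x v x v.

Lemma loop_C1_closed_curve g L : loop g L -> arclength_C1_closed_curve g L.
Proof.
move=> [x [v [[dg cg ug] L0 [g0 g'0] [gL g'L]]]].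
split; [exact: L0|split; [|split; [|split; [|split]]]].
- by move=> t _; exact: dg.
- exact: continuous_subspaceT.
- by move=> t _; exact: ug.
- by rewrite g0 gL.
- by rewrite g'0 g'L.
Qed.

Lemma loop_repeat g L (k : nat) : loop g L -> 0 < L -> exists2 g', loop g' (k.+1%:R * L) &
  forall Phi, continuous Phi -> curve_action g' (k.+1%:R * L) Phi = k.+1%:R * curve_action g L Phi.
Proof.
move=> [x [v A]] L0.
suff [g' A' E'] : exists2 g', arc g' (k.+1%:R * L) x v x v & forall Phi, continuous Phi ->
    curve_action g' (k.+1%:R * L) Phi = k.+1%:R * curve_action g L Phi.
  by exists g' => //; exists x, v.
elim: k => [|k [g' A' E']]; first by exists g => [|Phi _]; rewrite !mul1r.
have [g2 A2 E2] := arc_glue _ _ _ _ _ _ _ _ _ _ A' A.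
have kE : k.+2%:R * L = k.+1%:R * L + L by rewrite -natr1 mulrDl mul1r.
exists g2; rewrite kE// => Phi cPhi.
by rewrite E2// E'// -[k.+2%:R]natr1 mulrDl mul1r.
Qed.

Variable F : ('rV[R]_d -> 'rV[R]_d) -> R.
Hypothesis mF : finite_vector_measure F.
Hypothesis divF : div_free F.
Hypothesis hd : (2 <= d)%N.

Lemma div_free_le_of_loops Psi (r lam : R) : C0field Psi -> 0 <= r ->
  (forall x, r < enorm x -> Psi x = 0) -> 0 < lam ->
  (forall g L, loop g L -> 0 < L -> curve_action g L Psi <= lam * L) ->
  F Psi <= mnorm F * lam.
Proof.
move=> CPsi r0 Psi_out lam0 H; have [M M0 PsiM] := C0field_bounded _ CPsi.
have H' g L x v : arc g L x v x v -> 0 < L -> curve_action g L Psi <= lam * L.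
  by move=> A; apply: H; exists x, v.
have [u [B [r' [rr' u_out uB Hu]]]] :=
  @weak_kam R d hd Psi r lam M CPsi r0 Psi_out lam0 M0 PsiM H'.
apply/ler_addgt0Pr => e e0.
have m0 := mnorm_ge0 _ mF.
have m1 : 0 < mnorm F + 1 by rewrite ltr_wpDl.
(* Adding 1 keeps the quotient meaningful when the norm is zero. *)
have eta0 : 0 < e / (mnorm F + 1) by rewrite divr_gt0.
have [|phi [Ephi cphi] Hphi] := @smooth_subsolution R d Psi u lam B r' (ltW lam0) CPsi
  (le_trans r0 rr') _ u_out uB Hu _ eta0.
  by move=> x xr; apply: Psi_out; rewrite (le_lt_trans rr').
have [s Hs] := cphi.
have Cg : C0field (grad phi) by apply: C0field_grad Hs.
have -> : F Psi = F (fun x => grad phi x + Psi x).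
  by rewrite measureD// divF ?add0r//; exact: elementary_smooth.
rewrite (le_trans (measure_le _ mF _ _ _ _ Hphi))//.
- exact: C0fieldD.
- by rewrite addr_gt0.
rewrite mulrDr lerD2l mulrCA ger_pMr// ler_pdivrMr// mul1r lerDl.
exact: ler01.
Qed.

(** A loop of length at most 1 based at distance [r + 2] never meets the ball of radius [r]. It
    serves as a good loop when the mean action asked for is not positive. *)
Lemma exists_loop_far (r : R) : 0 <= r -> exists g L, [/\ loop g L, 0 < L <= 1 &
  forall Psi, continuous Psi -> (forall x, r < enorm x -> Psi x = 0) ->
    curve_action g L Psi = 0].
Proof.
move=> r0; pose i0 := Ordinal (ltnW hd); pose v : 'rV[R]_d := evec i0.
pose x : 'rV[R]_d := (r + 2) *: v.
have v1 : enorm v = 1 by exact: enorm_evec.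
have [g [L [/andP[L0 L1] A]]] := arc_reorient x v v 1 hd v1 v1 ltr01.
exists g, L; split; [by exists x, v|by rewrite L0|].
move=> Psi cPsi Psi_out; have [ug L0' [g0 _] _] := A.
apply/eqP; rewrite -normr_le0 -(mul0r L).
apply: curve_action_norm_le => // t /andP[t0 tL].
rewrite Psi_out ?enorm0//.
have := unit_speed_dist _ t ug t0; rewrite g0 enormB => h.
have := ler_enormD (x - g t) (g t); rewrite subrK.
have -> : enorm x = r + 2 by rewrite enormZ v1 mulr1 ger0_norm// addr_ge0.
lra.
Qed.

Lemma exists_good_loop Psi (r eta : R) : C0field Psi -> 0 <= r ->
  (forall x, r < enorm x -> Psi x = 0) -> 0 < eta ->
  exists g L, [/\ loop g L, 0 < L & (F Psi / mnorm F - eta) * L <= curve_action g L Psi].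
Proof.
move=> CPsi r0 Psi_out eta0; apply: contrapT => nH.
have H g L : loop g L -> 0 < L -> curve_action g L Psi <= (F Psi / mnorm F - eta) * L.
  move=> lg L0; rewrite leNgt; apply/negP => h; apply: nH.
  by exists g, L; split => //; exact: ltW.
have cPsi : continuous Psi by case: CPsi.
have [g [L [lg /andP[L0 _] E]]] := exists_loop_far _ r0.
(* The far loop has zero action, so the threshold is nonnegative. If it is zero, the far loop is
   itself good; if it is positive, the duality bound applies. *)
have := H _ _ lg L0; rewrite (E _ cPsi Psi_out) pmulr_lge0// le_eqVlt => /orP[/eqP z|l0].
  apply: nH; exists g, L; split => //.
  by rewrite -z mul0r E.
have := div_free_le_of_loops _ _ _ CPsi r0 Psi_out l0 H.
have m0 := mnorm_ge0 _ mF.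
(* With zero norm the quotient is 0 by convention and the threshold is [- eta], which contradicts
   its positivity. *)
have [mz|mn] := eqVneq (mnorm F) 0; first by move: l0; rewrite mz invr0 mulr0; lra.
have mp : 0 < mnorm F by rewrite lt_neqAle eq_sym mn.
rewrite mulrBr mulrCA divff// mulr1.
have := mulr_gt0 mp eta0; lra.
Qed.

Lemma exists_loop_average (I : finType) (Phi : I -> 'rV[R]_d -> 'rV[R]_d) (e : R) :
  (forall i, C0field (Phi i)) ->
  (forall i, exists r : R, forall x, r < enorm x -> Phi i x = 0) -> 0 < e ->
  exists (N : nat) (g : nat -> R -> 'rV[R]_d) (L : nat -> R),
  [/\ (0 < N)%N, forall j, loop (g j) (L j) /\ 0 < L j &
   forall i, `|\sum_(j < N) curve_action (g j) (L j) (Phi i) / L j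
      - N%:R * (F (Phi i) / mnorm F)| <= e * N%:R].
Proof.
move=> CPhi sPhi e0.
pose p i := F (Phi i) / mnorm F.
pose kap (gL : (R -> 'rV[R]_d) * R) i := curve_action gL.1 gL.2 (Phi i) / gL.2 - p i.
have cPhi i : continuous (Phi i) by case: (CPhi i).
have [M HM] : exists M : R, forall i x, enorm (Phi i x) <= M.
  have /choice[M HM] i : exists M : R, forall x, enorm (Phi i x) <= M.
    by have [M _ HM] := C0field_bounded _ (CPhi i); exists M.
  exists (\sum_i `|M i|) => i x; rewrite (le_trans (HM i x))// (le_trans (ler_norm _))//.
  by rewrite (bigD1 i)//= lerDl sumr_ge0.
have [r r0 Hr] : exists2 r : R, 0 <= r & forall i x, r < enorm x -> Phi i x = 0.
  have /choice[r Hr] := sPhi.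
  exists (\sum_i `|r i|); first exact: sumr_ge0.
  move=> i x xr; apply: (Hr i); rewrite (le_lt_trans _ xr)// (le_trans (ler_norm _))//.
  by rewrite (bigD1 i)//= lerDl sumr_ge0.
have step (c : I -> R) : exists gL : (R -> 'rV[R]_d) * R, [/\ loop gL.1 gL.2, 0 < gL.2 &
    -1 <= \sum_i c i * kap gL i].
  pose Psi x := \sum_i c i *: Phi i x.
  have CPsi : C0field Psi by apply: C0field_sum => i; exact: C0fieldZ.
  have Psi_out x : r < enorm x -> Psi x = 0.
    by move=> xr; apply: big1 => i _; rewrite (Hr _ _ xr) scaler0.
  (* A slack of 1 is enough whatever the size of [c], since the greedy choice only asks for a
     pairing of at least -1. *)
  have [g [L [lg L0 H]]] := exists_good_loop _ _ _ CPsi r0 Psi_out ltr01.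
  exists (g, L); split => //=.
  have [x [v [ug _ _ _]]] := lg.
  move: H; rewrite (curve_action_lin _ _ _ _ _ ug (ltW L0) cPhi).
  rewrite (measure_sum _ mF _ _ (fun i => C0fieldZ (c i) _ (CPhi i))).
  rewrite -ler_pdivlMr// lerBlDr -lerBlDl => H.
  have -> : \sum_i c i * kap (g, L) i = (\sum_i c i * curve_action g L (Phi i)) / L -
      (\sum_i F (fun x => c i *: Phi i x)) / mnorm F.
    rewrite !mulr_suml -sumrB; apply: eq_bigr => i _.
    by rewrite (measureZ _ mF)// /kap /p /= mulrBr !mulrA.
  by lra.
have kapB gL i : loop gL.1 gL.2 -> 0 < gL.2 -> `|kap gL i| <= M + `|p i|.
  move=> [x [v [ug L0 _ _]]] Lp; rewrite (le_trans (ler_normB _ _))// lerD2r.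
  rewrite normrM normfV (gtr0_norm Lp) ler_pdivrMr//.
  exact: curve_action_norm_le.
have [|gL i [] lg Lp|N [f [N0 Hf HN]]] := @greedy_average _ I _ kap
    (fun gL => loop gL.1 gL.2 /\ 0 < gL.2) (M + \sum_i `|p i|) _ _ _ e0.
- by move=> c; have [gL [? ? ?]] := step c; exists gL.
- rewrite (le_trans (kapB gL i lg Lp))// lerD2l (bigD1 i)//= lerDl.
  exact: sumr_ge0.
exists N, (fun j => (f j).1), (fun j => (f j).2); split=> // i.
have := HN i; rewrite sumrB sumr_const card_ord -[p i *+ N]mulr_natl.
by rewrite (mulrC e).
Qed.

(** The finitely many loops of an average have bounded length. Running [k + 1] times through a loop
    of length [L j], with [k] the integer part of [l / L j], overshoots [l] by at most [L j], which
    is negligible for large [l]. *)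
Lemma exists_long_loops (I : finType) (Phi : I -> 'rV[R]_d -> 'rV[R]_d) (e : R) :
  (forall i, C0field (Phi i)) ->
  (forall i, exists r : R, forall x, r < enorm x -> Phi i x = 0) -> 0 < e ->
  exists l0 : nat, forall l : nat, (l0 <= l)%N ->
  exists (N : nat) (g : nat -> R -> 'rV[R]_d) (L : nat -> R),
  [/\ (0 < N)%N, forall j, (j < N)%N -> loop (g j) (L j) /\ l%:R <= L j <= 2 * l%:R,
    forall j, (j < N)%N -> L j <= l%:R * (1 + e) &
   forall i, `|(N%:R * l%:R)^-1 * \sum_(j < N) curve_action (g j) (L j) (Phi i)
      - F (Phi i) / mnorm F| <= e].
Proof.
move=> CPhi sPhi e0; have e2 : 0 < e / 2 by rewrite divr_gt0.
have cPhi i : continuous (Phi i) by case: (CPhi i).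
have [N [g [L [N0 gL HN]]]] := exists_loop_average I Phi _ CPhi sPhi e2.
have [M M0 HM] : exists2 M : R, 0 <= M & forall i x, enorm (Phi i x) <= M.
  have /choice[M HM] i : exists M : R, forall x, enorm (Phi i x) <= M.
    by have [M _ HM] := C0field_bounded _ (CPhi i); exists M.
  exists (\sum_i `|M i|); first exact: sumr_ge0.
  move=> i x; rewrite (le_trans (HM i x))// (le_trans (ler_norm _))//.
  by rewrite (bigD1 i)//= lerDl sumr_ge0.
pose Lam := \sum_(j < N) L j.
have LLam j : (j < N)%N -> L j <= Lam.
  move=> jN; rewrite /Lam (bigD1 (Ordinal jN))//= lerDl sumr_ge0// => k _.
  by rewrite ltW//; case: (gL k).
have Lam0 : 0 <= Lam by apply: sumr_ge0 => k _; rewrite ltW//; case: (gL k).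
(* [X < l] forces both [Lam <= l], hence lengths at most [2 l], and [Lam (M + 1) <= l e / 2]. *)
pose X := Lam * (1 + (M + 1) / (e / 2)).
have X0 : 0 <= X by rewrite mulr_ge0// addr_ge0// divr_ge0 ?(ltW e2)// addr_ge0.
exists (Num.bound X) => l l0l.
have Xl : X < l%:R by rewrite (lt_le_trans (archi_boundP X0))// ler_nat.
have lp : 0 < l%:R :> R by exact: le_lt_trans Xl.
have Laml : Lam <= l%:R.
  by rewrite (le_trans _ (ltW Xl))// ler_peMr// lerDl divr_ge0 ?(ltW e2)// addr_ge0.
have LamM : Lam * (M + 1) <= l%:R * (e / 2).
  rewrite -ler_pdivrMr// (le_trans _ (ltW Xl))// -mulrA ler_wpM2l//.
  by rewrite lerDr.
pose k j := Num.truncn (l%:R / L j).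
have kP j : l%:R < (k j).+1%:R * L j <= l%:R + L j.
  have [_ Lj] := gL j.
  have lL : 0 <= l%:R / L j by rewrite divr_ge0// ltW.
  have /andP[k1 k2] := Num.Theory.truncn_itv lL.
  rewrite -/(k j) in k1 k2.
  rewrite -ltr_pdivrMr// k2/= -natr1 mulrDl mul1r lerD2r -ler_pdivlMr//.
have /choice[g' Hg'] j : exists g', loop g' ((k j).+1%:R * L j) /\
    forall Phi, continuous Phi ->
    curve_action g' ((k j).+1%:R * L j) Phi = (k j).+1%:R * curve_action (g j) (L j) Phi.
  have [lg Lj] := gL j; have [g' ? ?] := loop_repeat _ _ (k j) lg Lj.
  by exists g'.
exists N, g', (fun j => (k j).+1%:R * L j); split=> //.
- move=> j jN; have [? _] := Hg' j; split=> //; have /andP[k1 k2] := kP j.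
  rewrite (ltW k1)/= (le_trans k2)// mulrDl mul1r lerD2l.
  by rewrite (le_trans (LLam _ jN)).
- move=> j jN; have /andP[k1 k2] := kP j.
  rewrite (le_trans k2)// mulrDr mulr1 lerD2l (le_trans (LLam _ jN))//.
  have : Lam <= Lam * (M + 1) by rewrite ler_peMr// lerDr.
  by move=> h; rewrite (le_trans h)// (le_trans LamM)//
    ler_pM2l// ler_pdivrMr// ler_peMr ?ler1n ?(ltW e0).
move=> i; set p := F (Phi i) / mnorm F.
have NR : 0 < N%:R :> R by rewrite ltr0n.
have Nl : 0 < N%:R * l%:R :> R by rewrite mulr_gt0.
rewrite -(ler_pM2l Nl) -[X in X * `|_|](gtr0_norm Nl) -normrM mulrBr mulrA mulfV ?gt_eqF// mul1r.
(* The error splits into the excess lengths, each at most [Lam], weighted by mean actions of size at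
   most [M], and [l] times the error of the original average. Each part takes half of [N l e]. *)
have -> : \sum_(j < N) curve_action (g' j) ((k j).+1%:R * L j) (Phi i) - N%:R * l%:R * p =
  \sum_(j < N) (((k j).+1%:R * L j - l%:R) * (curve_action (g j) (L j) (Phi i) / L j)) +
   l%:R * (\sum_(j < N) curve_action (g j) (L j) (Phi i) / L j - N%:R * p).
  rewrite mulrBr mulr_sumr addrA -big_split /= [in RHS]mulrA (mulrC l%:R N%:R).
  congr (_ - _); apply: eq_bigr => j _; have [_ ->//] := Hg' j.
  by have [_ Lj] := gL j; field; exact: lt0r_neq0.
rewrite (le_trans (ler_normD _ _))//.
have -> : N%:R * l%:R * e = N%:R * (l%:R * (e / 2)) + l%:R * (e / 2 * N%:R) by field.
apply: lerD; last by rewrite normrM (gtr0_norm lp) ler_pM2l.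
rewrite (le_trans (ler_norm_sum _ _ _))//.
apply: (@le_trans _ _ (\sum_(j < N) (l%:R * (e / 2)))); last first.
  by rewrite sumr_const card_ord -[leLHS]mulr_natl.
apply: ler_sum => j _; have /andP[k1 k2] := kP j; have [[x [v [ug _ _ _]]] Lj] := gL j.
rewrite normrM (le_trans _ LamM)//; apply: ler_pM => //.
  rewrite ger0_norm; last by rewrite subr_ge0 ltW.
  by rewrite lerBlDl (le_trans k2)// lerD2l LLam.
rewrite normrM normfV (gtr0_norm Lj) ler_pdivrMr//.
rewrite (@le_trans _ _ (M * L j))//; last by rewrite ler_wpM2r ?(ltW Lj)// lerDl.
apply: curve_action_norm_le => //; exact: ltW.
Qed.

(** Supplies a curve of admissible length for those [l] at which no accuracy is claimed yet. For
    [l = 0] the length is 0. *)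
Lemma exists_loop_length (l : nat) : exists g L, loop g L /\ l%:R <= L <= 2 * l%:R.
Proof.
have [g [L [lg /andP[L0 L1] _]]] := exists_loop_far 0 (lexx 0).
case: l => [|l].
  pose v : 'rV[R]_d := evec (Ordinal (ltnW hd)).
  exists (fun t => 0 + t *: v), 0; split; last by rewrite mulr0 lexx.
  exists 0, v; have := arc_segment 0 v 0 (enorm_evec _) (lexx _).
  by rewrite scale0r addr0.
pose k := Num.truncn (l.+1%:R / L).
have lL : 0 <= l.+1%:R / L by rewrite divr_ge0// ltW.
have /andP[k1 k2] := Num.Theory.truncn_itv lL.
have [g' lg' _] := loop_repeat _ _ k lg L0.
exists g', (k.+1%:R * L); split=> //.
rewrite -ler_pdivrMr// (ltW k2)/= -natr1 mulrDl mul1r [leRHS]mulrDl mul1r lerD//.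
  by rewrite -ler_pdivlMr.
by rewrite (le_trans L1)// ler1n.
Qed.

End Loops.

(** * Reduction to finitely many test fields *)

Section TestFields.
Context {R : realType} {d : nat}.
Implicit Types (x : 'rV[R]_d) (Phi : 'rV[R]_d -> 'rV[R]_d).

Definition mesh (n : nat) : R := n.+1%:R^-1.
(* Enough cells for the grid to cover the cube of half-side [n + 1]. *)
Definition cells (n : nat) : nat := (n.+1 * n.+1).+1.
(** The trivial factors 1 give the shape of the partition of unity [sum_bump] with bumps as wide as
    the mesh, so that the weights add up to 1. *)
Definition node (n : nat) := @gridpt R d (mesh n / 1%:R) (cells n * 1).
Definition test_index (n : nat) : finType :=
  ({ffun 'I_d -> 'I_(2 * (cells n * 1)).+1} * 'I_d)%type.
Definition test_field (n : nat) (i : test_index n) x : 'rV[R]_d :=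
  bump (mesh n) (x - node n i.1) *: evec i.2.
Definition interp (n : nat) Phi x : 'rV[R]_d :=
  \sum_(i : test_index n) Phi (node n i.1) ord0 i.2 *: test_field n i x.

Lemma mesh_gt0 n : 0 < mesh n.
Proof. by rewrite invr_gt0. Qed.

Lemma test_field_out n (i : test_index n) : exists r : R,
  forall x, r < enorm x -> bump (mesh n) (x - node n i.1) = 0.
Proof.
exists (d%:R * mesh n + enorm (node n i.1)) => x xr; apply: bump_out (mesh_gt0 n) _.
by have := ler_enormD (x - node n i.1) (node n i.1); rewrite subrK; lra.
Qed.

Lemma test_field_C0 n (i : test_index n) : C0field (test_field n i).
Proof.
have [r Hr] := test_field_out n i; apply: (C0field_scal _ _ r) => // x.
exact/differentiable_continuous/elementary_differentiable/elementary_bump.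
Qed.

Lemma interpE n Phi x : interp n Phi x =
  \sum_k bump (mesh n) (x - node n k) *: Phi (node n k).
Proof.
rewrite /interp -(pair_bigA _ (fun k j => Phi (node n k) ord0 j *:
  (bump (mesh n) (x - node n k) *: evec j))) /=.
apply: eq_bigr => k _; rewrite [in RHS](row_sum_evec (Phi (node n k))) scaler_sumr.
by apply: eq_bigr => j _; rewrite !scalerA mulrC.
Qed.

Lemma interp_C0 n Phi : C0field (interp n Phi).
Proof. by apply: C0field_sum => i; apply/C0fieldZ/test_field_C0. Qed.

(** A bump only sees nodes within [d * mesh n] of [x]. Inside the cube the weights add up to 1 and
    uniform continuity applies; the growth of the cube takes care of the rest. *)
Lemma interp_cvg Phi (eta : R) : C0field Phi -> 0 < eta ->
  exists n0 : nat, forall n, (n0 <= n)%N ->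
    forall x, enorm (interp n Phi x - Phi x) <= eta.
Proof.
move=> CPhi eta0; have e2 : 0 < eta / 2 by rewrite divr_gt0.
have [del del0 Hdel] := C0field_unif_continuous _ CPhi _ eta0.
have [_ /(_ _ e2)[r Hr]] := CPhi.
exists (Num.bound (`|r| + 1 + d%:R / del)) => n n0n.
have X0 : 0 <= `|r| + 1 + d%:R / del by rewrite !addr_ge0// divr_ge0// ltW.
have Xn : `|r| + 1 + d%:R / del < n%:R.
  by rewrite (lt_le_trans (archi_boundP X0))// ler_nat.
have m0 := mesh_gt0 n.
have dm : d%:R * mesh n < del.
  rewrite /mesh ltr_pdivrMr// mulrC -ltr_pdivrMr// (le_lt_trans _ (lt_le_trans Xn _))//.
    by rewrite lerDr addr_ge0.
  by rewrite ler_nat.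
have m1 : mesh n <= 1 by rewrite /mesh invf_le1// ler1n.
move=> x; rewrite interpE.
have [/forallP hx|/existsP[j]] := boolP [forall j, `|x ord0 j| <= ((cells n)%:R - 1) * mesh n].
  have S1 := sum_bump (mesh n) 1 (cells n) x m0 isT hx; rewrite expr1n in S1.
  have -> : \sum_k bump (mesh n) (x - node n k) *: Phi (node n k) - Phi x =
      \sum_k bump (mesh n) (x - node n k) *: (Phi (node n k) - Phi x).
    under [in RHS]eq_bigr do rewrite scalerBr.
    by rewrite sumrB -scaler_suml S1 scale1r.
  apply: (le_trans (ler_enorm_sum _ _)).
  rewrite -[leRHS]mul1r -S1 mulr_suml; apply: ler_sum => k _.
  rewrite enormZ ger0_norm ?bump_ge0//.
  have [->|/(bump_neq0 _ _ m0) hk] := eqVneq (bump (mesh n) (x - node n k)) 0.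
    by rewrite mul0r mulr_ge0 ?bump_ge0 ?(ltW eta0).
  rewrite ler_wpM2l ?bump_ge0// ltW// Hdel// (le_lt_trans _ dm)// enormB.
  by apply: ler_enorm_coord => j; exact/ltW/hk.
(* Outside the cube the weights add up to at most 1, and both [x] and the nodes it sees are so far
   out that [Phi] is below [eta / 2] there. *)
rewrite -ltNge => xj.
have cm : ((cells n)%:R - 1) * mesh n = n.+1%:R.
  by rewrite /cells -[(_ * _).+1%:R]natr1 addrK natrM /mesh mulfK// pnatr_eq0.
rewrite cm in xj.
have rx : r + 1 < `|x ord0 j|.
  rewrite (lt_trans _ xj)// -natr1 ltrD2r (le_lt_trans (ler_norm _))//.
  rewrite (le_lt_trans _ Xn)// -addrA lerDl addr_ge0// divr_ge0// ltW//.
rewrite (le_trans (ler_enormB _ _))// [leRHS]splitr lerD//; last first.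
  by apply/ltW/Hr; have := ler_coord_enorm x j; lra.
apply: (le_trans (ler_enorm_sum _ _)).
have S1 := sum_bump_le (mesh n) 1 (cells n) x m0 isT; rewrite expr1n in S1.
rewrite -[leRHS]mul1r (le_trans _ (ler_wpM2r (ltW e2) S1))// mulr_suml.
apply: ler_sum => k _; rewrite enormZ ger0_norm ?bump_ge0//.
have [->|/(bump_neq0 _ _ m0) hk] := eqVneq (bump (mesh n) (x - node n k)) 0.
  by rewrite mul0r mulr_ge0 ?bump_ge0 ?(ltW e2).
rewrite ler_wpM2l ?bump_ge0// ltW// Hr//.
have := hk j; rewrite !mxE -/(node n k) => hkj.
have := ler_coord_enorm (node n k) j.
have := ler_normD (x ord0 j - node n k ord0 j) (node n k ord0 j); rewrite subrK.
move: hkj; rewrite [node n k ord0 j]mxE; lra.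
Qed.

End TestFields.

(** * From the test fields to all vanishing fields *)

Section Approximation.
Context {R : realType} {d : nat}.
Implicit Types (g : R -> 'rV[R]_d) (L : R) (Phi Psi : 'rV[R]_d -> 'rV[R]_d).

Lemma curve_actionB g L Phi Psi : unit_speed g -> 0 <= L ->
  continuous Phi -> continuous Psi ->
  curve_action g L (fun x => Phi x - Psi x) = curve_action g L Phi - curve_action g L Psi.
Proof.
move=> ug L0 cPhi cPsi.
have := @curve_action_lin _ _ g L bool (fun b => if b then 1 else -1)
  (fun b => if b then Phi else Psi) ug L0.
rewrite big_bool /= mul1r mulN1r => <-; last by case.
by congr curve_action; apply/funext => x; rewrite big_bool /= scale1r scaleN1r.
Qed.

Definition loop_average (N : nat) (g : nat -> R -> 'rV[R]_d) (L : nat -> R) (l : nat) Phi : R :=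
  (N%:R * l%:R)^-1 * \sum_(j < N) curve_action (g j) (L j) Phi.

Variables (F : ('rV[R]_d -> 'rV[R]_d) -> R).
Hypothesis mF : finite_vector_measure F.

(** If the norm is zero, then [F] vanishes on vanishing fields, so the identity survives the
    convention for division by 0. *)
Lemma measure_mnormE Phi : C0field Phi -> F Phi = mnorm F * (F Phi / mnorm F).
Proof.
move=> CPhi; have [m0|mn] := eqVneq (mnorm F) 0; last by rewrite mulrCA divff// mulr1.
have [M M0 HM] := C0field_bounded _ CPhi.
have M1 : 0 < M + 1 by rewrite ltr_wpDl.
have := measure_norm_le _ mF _ _ CPhi M1 (fun x => le_trans (HM x) _).
rewrite m0 mul0r normr_le0 => /(_ _)/eqP ->; first by rewrite mul0r.
by rewrite lerDl.
Qed.

(** Replacing [Phi] by its interpolation costs [2 eta] in the average, as lengths are at most [2 l],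
    and [eta] in [F]. The interpolation is a combination of the test fields with coefficients at
    most [M], so their errors add up to at most [#|test_index n| M e]. *)
Lemma loop_average_close (N : nat) (g : nat -> R -> 'rV[R]_d) (L : nat -> R) (l n : nat)
    Phi (eta M e : R) : (0 < l)%N -> (0 < N)%N -> C0field Phi -> 0 < eta ->
  (forall j, (j < N)%N -> loop (g j) (L j) /\ L j <= 2 * l%:R) ->
  (forall x, enorm (Phi x) <= M) -> (forall x, enorm (interp n Phi x - Phi x) <= eta) ->
  (forall i : @test_index d n,
     `|loop_average N g L l (test_field n i) - F (test_field n i) / mnorm F| <= e) ->
  `|mnorm F * loop_average N g L l Phi - F Phi| <=
    mnorm F * (3 * eta + #|@test_index d n|%:R * (M * e)).
Proof.
move=> l0 N0 CPhi eta0 HL HM Hint He.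
have lR : 0 < l%:R :> R by rewrite ltr0n.
have NR : 0 < N%:R :> R by rewrite ltr0n.
have Nl : 0 < N%:R * l%:R :> R by rewrite mulr_gt0.
have CI := interp_C0 n Phi.
have cI : continuous (interp n Phi) by case: CI.
have cPhi : continuous Phi by case: CPhi.
have Cd := C0fieldB _ _ CI CPhi.
have A1 : `|loop_average N g L l (interp n Phi) - loop_average N g L l Phi| <= 2 * eta.
  rewrite /loop_average -mulrBr -sumrB normrM gtr0_norm ?invr_gt0// ler_pdivrMl//.
  rewrite (le_trans (ler_norm_sum _ _ _))//.
  apply: (@le_trans _ _ (\sum_(j < N) (eta * (2 * l%:R)))); last first.
    by rewrite sumr_const card_ord -[leLHS]mulr_natl; lra.
  apply: ler_sum => j _; have [[x [v [ug Lj _ _]]] L2] := HL j (ltn_ord j).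
  rewrite -curve_actionB// (le_trans (curve_action_norm_le _ _ _ eta ug _ Lj _))//.
    by case: Cd.
  by rewrite ler_wpM2l// ltW.
have A2 : `|loop_average N g L l (interp n Phi) - F (interp n Phi) / mnorm F| <=
    #|@test_index d n|%:R * (M * e).
  have -> : loop_average N g L l (interp n Phi) =
      \sum_(i : @test_index d n) Phi (node n i.1) ord0 i.2 * loop_average N g L l (test_field n i).
    rewrite /loop_average.
    under [in RHS]eq_bigr do rewrite mulrCA mulr_sumr.
    rewrite -mulr_sumr exchange_big /=; congr (_ * _); apply: eq_bigr => j _.
    have [[x [v [ug Lj _ _]]] L2] := HL j (ltn_ord j).
    rewrite curve_action_lin// => i.
    by have [] := @test_field_C0 R d n i.
  have -> : F (interp n Phi) =
      \sum_(i : @test_index d n) Phi (node n i.1) ord0 i.2 * F (test_field n i).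
    rewrite (measure_sum _ mF _ _ (fun i => C0fieldZ _ _ (test_field_C0 n i))).
    by apply: eq_bigr => i _; rewrite (measureZ _ mF)//; exact: test_field_C0.
  rewrite mulr_suml -sumrB (le_trans (ler_norm_sum _ _ _))//.
  apply: (@le_trans _ _ (\sum_(i : @test_index d n) M * e)); last first.
    by rewrite sumr_const -[leLHS]mulr_natl.
  apply: ler_sum => i _; rewrite -mulrA -mulrBr normrM; apply: ler_pM => //.
  by rewrite (le_trans (ler_coord_enorm _ _)).
have A3 : `|F (interp n Phi) - F Phi| <= mnorm F * eta.
  by rewrite -(measureB _ mF)//; exact: measure_norm_le.
have m0 := mnorm_ge0 _ mF.
have -> : mnorm F * loop_average N g L l Phi - F Phi =
  - (mnorm F * (loop_average N g L l (interp n Phi) - loop_average N g L l Phi)) +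
  mnorm F * (loop_average N g L l (interp n Phi) - F (interp n Phi) / mnorm F) +
  (F (interp n Phi) - F Phi).
  by rewrite !mulrBr -(measure_mnormE _ CI); ring.
have B1 := ler_wpM2l m0 A1; have B2 := ler_wpM2l m0 A2.
rewrite -(ger0_norm m0) -normrM in B1; rewrite -(ger0_norm m0) -normrM in B2.
rewrite (le_trans (ler_normD _ _))//.
have := ler_normD (- (mnorm F * (loop_average N g L l (interp n Phi) - loop_average N g L l Phi)))
   (mnorm F * (loop_average N g L l (interp n Phi) - F (interp n Phi) / mnorm F)).
rewrite normrN; rewrite (ger0_norm m0) in B1 B2 *; lra.
Qed.

End Approximation.

(** Diagonal choice: at stage [l] the finest level [n <= l] whose threshold [l0 n] has been passed
    is used, so every [m] is eventually dominated. The accuracy is divided by the number of test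
    fields because their errors are summed. *)
Lemma exists_loop_systems {R : realType} {d : nat} (F : ('rV[R]_d -> 'rV[R]_d) -> R) :
  (2 <= d)%N -> finite_vector_measure F -> div_free F ->
  exists l0 : nat -> nat, forall l : nat,
  exists D : nat * (nat -> R -> 'rV[R]_d) * (nat -> R),
  [/\ (0 < D.1.1)%N,
   forall j, (j < D.1.1)%N -> loop (D.1.2 j) (D.2 j) /\ l%:R <= D.2 j <= 2 * l%:R &
   forall m, (m <= l)%N -> (l0 m <= l)%N -> exists2 n, (m <= n)%N &
     (forall j, (j < D.1.1)%N -> D.2 j <= l%:R * (1 + n.+1%:R^-1)) /\
     forall i : @test_index d n, `|loop_average D.1.1 D.1.2 D.2 l (test_field n i)
        - F (test_field n i) / mnorm F| <= (n.+1 * #|@test_index d n|.+1)%:R^-1].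
Proof.
move=> hd mF divF.
have /choice[l0 Hl0] : forall n, exists l0 : nat, forall l : nat, (l0 <= l)%N ->
  exists D : nat * (nat -> R -> 'rV[R]_d) * (nat -> R),
  [/\ (0 < D.1.1)%N,
   forall j, (j < D.1.1)%N -> loop (D.1.2 j) (D.2 j) /\ l%:R <= D.2 j <= 2 * l%:R &
   (forall j, (j < D.1.1)%N -> D.2 j <= l%:R * (1 + n.+1%:R^-1)) /\
     forall i : @test_index d n, `|loop_average D.1.1 D.1.2 D.2 l (test_field n i)
        - F (test_field n i) / mnorm F| <= (n.+1 * #|@test_index d n|.+1)%:R^-1].
  move=> n; have e0 : 0 < (n.+1 * #|@test_index d n|.+1)%:R^-1 :> R.
    by rewrite invr_gt0 ltr0n.
  have [|l0 Hl0] := @exists_long_loops R d F mF divF hd (@test_index d n)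
    (test_field n) _ (test_field_C0 n) _ e0.
    move=> i; have [r Hr] := @test_field_out R d n i; exists r => x /Hr h.
    by rewrite /test_field h scale0r.
  exists l0 => l /Hl0[N [g [L [N0 H1 H2 H3]]]]; exists (N, g, L); split=> //=; split=> // j jN.
  rewrite (le_trans (H2 j jN))// ler_wpM2l// lerD2l lef_pV2 ?posrE ?ltr0n// ler_nat.
  by rewrite leq_pmulr.
exists l0 => l.
(* While no level is available, any curve of admissible length will do and the last clause is
   vacuous. *)
have [ex|nex] := pselect (exists n, (n <= l)%N && (l0 n <= l)%N); last first.
  have [g [L [lg HL]]] := @exists_loop_length R d hd l.
  exists (1%N, fun=> g, fun=> L); split=> //= m ml l0m.
  by exfalso; apply: nex; exists m; rewrite ml l0m.
have [n /andP[nl l0n] nmax] := ex_maxnP ex (fun m (h : (m <= l)%N && (l0 m <= l)%N) =>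
  (andP h).1).
have [D [D0 D1 D2]] := Hl0 n l l0n.
exists D; split=> // m ml l0m; exists n => //.
by apply: nmax; rewrite ml.
Qed.

Theorem theorem1p4 (R : realType) (d : nat) (hd : (2 <= d)%N)
    (F : ('rV[R]_d -> 'rV[R]_d) -> R) :
  finite_vector_measure F -> div_free F ->
  exists (n : nat -> nat) (L : nat -> nat -> R) (gamma : nat -> nat -> R -> 'rV[R]_d),
    (forall l, (0 < n l)%N) /\
    (forall l i, (i < n l)%N ->
       arclength_C1_closed_curve (gamma i l) (L i l) /\
       l%:R <= L i l <= 2 * l%:R) /\
    (forall Phi, C0field Phi ->
       (fun l : nat => mnorm F / ((n l)%:R * l%:R) *
          \sum_(i < n l) curve_action (gamma i l) (L i l) Phi) @ \oo --> F Phi) /\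
    (fun l : nat => ((n l)%:R * l%:R)^-1 * \sum_(i < n l) L i l) @ \oo --> (1 : R).
Proof.
move=> mF divF; have [l0 /choice[D HD]] := exists_loop_systems _ hd mF divF.
pose n l := (D l).1.1.
exists n, (fun i l => (D l).2 i), (fun i l => (D l).1.2 i).
have n0 l : (0 < n l)%N by case: (HD l).
have lp l i : (i < n l)%N -> loop ((D l).1.2 i) ((D l).2 i) /\ l%:R <= (D l).2 i <= 2 * l%:R.
  by case: (HD l) => _ + _; apply.
split; [exact: n0|split; [|split]].
- by move=> l i /lp[/loop_C1_closed_curve ? ?]; split.
- move=> Phi CPhi; apply/cvgrPdist_le => e e0.
  have m0 := mnorm_ge0 _ mF.
  have m1 : 0 < mnorm F + 1 by rewrite ltr_wpDl.
  (* Three parts pay for the interpolation, the fourth for the errors on the test fields. *)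
  pose eta := e / (mnorm F + 1) / 4; have eta0 : 0 < eta by rewrite !divr_gt0.
  have [M M0 HM] := C0field_bounded _ CPhi.
  have [n1 Hn1] := interp_cvg _ _ CPhi eta0.
  have Meta0 : 0 <= M / eta by rewrite divr_ge0// ltW.
  (* A level [k >= m] interpolates [Phi] up to [eta] and satisfies [M / (k + 1) <= eta]. *)
  pose m := maxn n1 (Num.bound (M / eta)).
  near=> l.
  have l_gt0 : (0 < l)%N by near: l; exact: nbhs_infty_gt.
  have ml : (m <= l)%N by near: l; exact: nbhs_infty_ge.
  have l0l : (l0 m <= l)%N by near: l; exact: nbhs_infty_ge.
  have [_ _ /(_ m ml l0l)[k mk [_ Hk]]] := HD l.
  have n1k : (n1 <= k)%N by rewrite (leq_trans _ mk)// leq_maxl.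
  have Mk : M <= eta * k.+1%:R.
    rewrite mulrC -ler_pdivrMr// ltW// (lt_le_trans (archi_boundP Meta0))// ler_nat.
    by rewrite (leq_trans _ (leqnSn _))// (leq_trans _ mk)// leq_maxr.
  rewrite distrC.
  have HL j : (j < n l)%N -> loop ((D l).1.2 j) ((D l).2 j) /\ (D l).2 j <= 2 * l%:R.
    by move=> /lp[? /andP[]].
  rewrite -[_ / _ * _]mulrA -/(loop_average (n l) (D l).1.2 (D l).2 l Phi).
  have H := @loop_average_close R d F mF (n l) (D l).1.2 (D l).2 l k Phi eta M _ l_gt0 (n0 l)
    CPhi eta0 HL HM (Hn1 k n1k) Hk.
  apply: (le_trans H).
  have B : #|@test_index d k|%:R * (M * (k.+1 * #|@test_index d k|.+1)%:R^-1) <= eta.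
    rewrite mulrA ler_pdivrMr ?ltr0n// natrM mulrA mulrC.
    by apply: ler_pM => //; rewrite ler_nat.
  rewrite (@le_trans _ _ (mnorm F * (4 * eta)))//.
    have -> : 4 * eta = 3 * eta + eta by ring.
    by rewrite ler_wpM2l// lerD2l.
  have -> : 4 * eta = e / (mnorm F + 1) by rewrite /eta mulrC divfK.
  by rewrite mulrCA ger_pMr// ler_pdivrMr// mul1r lerDl.
- apply/cvgrPdist_le => e e0.
  have e0' : 0 <= 1 / e by rewrite divr_ge0// ltW.
  pose m := Num.bound (1 / e).
  near=> l.
  have l_gt0 : (0 < l)%N by near: l; exact: nbhs_infty_gt.
  have ml : (m <= l)%N by near: l; exact: nbhs_infty_ge.
  have l0l : (l0 m <= l)%N by near: l; exact: nbhs_infty_ge.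
  have [_ _ /(_ m ml l0l)[k mk [Hk _]]] := HD l.
  have lR : 0 < l%:R :> R by rewrite ltr0n.
  have nl : 0 < (n l)%:R * l%:R :> R by rewrite mulr_gt0// ltr0n.
  (* At this level every length lies between [l] and [l (1 + e)], so the normalised total length
     lies between 1 and [1 + e]. *)
  have ke : k.+1%:R^-1 <= e.
    rewrite -[e]invrK lef_pV2 ?posrE ?invr_gt0// -[e^-1]mul1r ltW//.
    rewrite (lt_le_trans (archi_boundP e0'))// ler_nat.
    by rewrite (leq_trans mk).
  have S1 : (n l)%:R * l%:R <= \sum_(i < n l) (D l).2 i.
    rewrite mulr_natl -[X in _ *+ X]card_ord -sumr_const; apply: ler_sum => i _.
    by have [_ /andP[]] := lp l i (ltn_ord i).
  have S2 : \sum_(i < n l) (D l).2 i <= (n l)%:R * l%:R * (1 + e).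
    rewrite -mulrA mulr_natl -[X in _ *+ X]card_ord -sumr_const; apply: ler_sum => i _.
    by rewrite (le_trans (Hk i (ltn_ord i)))// ler_pM2l// lerD2l.
  rewrite distrC ger0_norm; last by rewrite subr_ge0 ler_pdivlMl// mulr1.
  by rewrite lerBlDl ler_pdivrMl.
Unshelve. all: by end_near. Qed.
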